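(* The map $\Delta^\infty:\mathcal{M}_r(\mathbb{C})\to\mathcal{M}_r(\mathbb{C})$, $\Delta^\infty(T)=\lim_{n\to\infty}\Delta^n(T)$, is continuous on $\mathcal{G}l_r(\mathbb{C})$.
   Context: $\mathcal{M}_r(\mathbb{C})$ denotes the complex $r\times r$ matrices and $\mathcal{G}l_r(\mathbb{C})$ the invertible ones. For $T$ with polar decomposition $T=U|T|$, the Aluthge transform is $\Delta(T)=|T|^{1/2}U|T|^{1/2}$; $\Delta^0(T)=T$, $\Delta^n(T)=\Delta(\Delta^{n-1}(T))$. It is known (and used as a fact here) that for every $T\in\mathcal{M}_r(\mathbb{C})$ the limit $\lim_{n\to\infty}\Delta^n(T)$ exists, so $\Delta^\infty$ is well defined on $\mathcal{M}_r(\mathbb{C})$. *)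

(* Defs.v *)
From mathcomp Require Import all_boot all_order all_algebra.
From mathcomp Require Import complex spectral.
From mathcomp Require Import all_classical all_reals all_analysis.
Import numFieldNormedType.Exports.
Import Order.TTheory GRing.Theory Num.Theory.

Set Implicit Arguments.
Unset Strict Implicit.
Unset Printing Implicit Defensive.

Local Open Scope classical_set_scope.
Local Open Scope ring_scope.

(* The complex numbers: C = R[i] for a real field R (realType), seen as a
   numClosedFieldType (so that it carries its usual metric topology, and
   matrices over it the product (= any norm) topology). *)
Definition Cplx (R : realType) : numClosedFieldType := R[i]%C.

Section Aluthge.
Context {R : realType}.
Local Notation C := (Cplx R).

Definition ctmx {m n : nat} (A : 'M[C]_(m, n)) : 'M[C]_(n, m) :=
  (map_mx Num.conj A)^T.

Context {r : nat}.

Definition psdmx (A : 'M[C]_r) : Prop :=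
  ctmx A = A /\ forall v : 'cV[C]_r, 0 <= (ctmx v *m A *m v) 0 0.

Definition psd_sqrt (A : 'M[C]_r) : 'M[C]_r :=
  xget 0 [set B | psdmx B /\ B *m B = A].

Definition absmx (T : 'M[C]_r) : 'M[C]_r := psd_sqrt (ctmx T *m T).

Definition polarU (T : 'M[C]_r) : 'M[C]_r :=
  xget 1%:M [set U | U \is unitarymx /\ T = U *m absmx T].

Definition aluthge (T : 'M[C]_r) : 'M[C]_r :=
  psd_sqrt (absmx T) *m polarU T *m psd_sqrt (absmx T).

Definition aluthge_iter (n : nat) (T : 'M[C]_r) : 'M[C]_r := iter n aluthge T.

Definition aluthge_inf (T : 'M[C]_r) : 'M[C]_r :=
  lim ((fun n => aluthge_iter n T) @ \oo).

End Aluthge.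

(* Main.v *)
(** Write [Delta S = G S G^-1] with [A = |S|], [G = A^(1/2)], for invertible [S].
  If [Y] commutes with [S = U A] then [A Y A^-1 = U^* Y U] has the Frobenius norm
  of [Y]; hence [|Y|^2 - |G Y G^-1|^2 = |A Y A^-1 - Y|^2 / 2], and conjugation
  along the orbit does not increase the norm of anything commuting with [S]: of
  [S], of [S^-1], of spectral idempotents of [S].  For an idempotent [E] this
  expresses the decrease of [|E - E^*|^2] by [d^2], where [d = |A E A^-1 - E|]
  also bounds the displacement of [E].  Near an invertible normal [N] whose
  eigenvalues are separated, [|E - E^*| <= L d] for the idempotents [E] of [S]
  belonging to the clusters around the eigenvalues of [N]; so the displacements
  are summable, the idempotents stay near the spectral projections of [N], and
  [N] is Lyapunov stable for [Delta].  Limit points of an orbit are normal, since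
  the decrease of [|S|^2] controls [S S^* - S^* S]; being stable, they are limits.
  Stability together with the continuity of each [Delta^n] gives the theorem. *)

From HB Require Import structures.
Require Import Defs.
From mathcomp Require Import all_boot all_order all_algebra.
From mathcomp Require Import complex spectral ring lra.
From mathcomp Require Import all_classical all_reals all_analysis.
Import numFieldNormedType.Exports.
Import Order.TTheory GRing.Theory Num.Theory.

Set Implicit Arguments.
Unset Strict Implicit.
Unset Printing Implicit Defensive.

Local Open Scope classical_set_scope.
Local Open Scope ring_scope.

(** * Frobenius norm *)

Lemma mulmx_rcancel (K : pzSemiRingType) m n (X : 'M[K]_(m, n)) (P Q : 'M[K]_n) :
  P *m Q = 1%:M -> X *m P *m Q = X.
Proof. by move=> PQ; rewrite -mulmxA PQ mulmx1. Qed.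

Section ConjugateTranspose.
Context {R : realType}.
Local Notation C := (Cplx R).

Lemma ctmxK m n (A : 'M[C]_(m, n)) : ctmx (ctmx A) = A.
Proof. by apply/matrixP => i j; rewrite !mxE conjCK. Qed.

Lemma ctmxM m n p (A : 'M[C]_(m, n)) (B : 'M[C]_(n, p)) :
  ctmx (A *m B) = ctmx B *m ctmx A.
Proof. by rewrite /ctmx map_mxM trmx_mul. Qed.

Lemma ctmxD m n (A B : 'M[C]_(m, n)) : ctmx (A + B) = ctmx A + ctmx B.
Proof. by rewrite /ctmx map_mxD linearD. Qed.

Lemma ctmxN m n (A : 'M[C]_(m, n)) : ctmx (- A) = - ctmx A.
Proof. by rewrite /ctmx map_mxN linearN. Qed.

Lemma ctmxB m n (A B : 'M[C]_(m, n)) : ctmx (A - B) = ctmx A - ctmx B.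
Proof. by rewrite ctmxD ctmxN. Qed.

Lemma ctmxE m n (A : 'M[C]_(m, n)) : ctmx A = map_mx Num.conj (A^T).
Proof. by rewrite /ctmx map_trmx. Qed.

End ConjugateTranspose.

Definition re {R : realType} (z : Cplx R) : R := complex.Re z.
Definition im {R : realType} (z : Cplx R) : R := complex.Im z.

(** The real part of the Hermitian product suffices for norms and is symmetric. *)
HB.lock Definition fdot (R : realType) m n (X Y : 'M[Cplx R]_(m, n)) : R :=
  re (\tr (X *m ctmx Y)).
HB.lock Definition fnorm (R : realType) m n (X : 'M[Cplx R]_(m, n)) : R :=
  Num.sqrt (fdot X X).

Section Frobenius.
Context {R : realType}.
Local Notation C := (Cplx R).
Local Notation re := (@re R).
Local Notation im := (@im R).

Lemma reD x y : re (x + y) = re x + re y.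
Proof. by case: x => a b; case: y. Qed.

Lemma reN x : re (- x) = - re x.
Proof. by case: x. Qed.

Lemma re0 : re 0 = 0. Proof. by []. Qed.

Lemma re_sum (I : Type) (s : seq I) (P : pred I) (F : I -> C) :
  re (\sum_(i <- s | P i) F i) = \sum_(i <- s | P i) re (F i).
Proof. exact: (big_morph re reD re0). Qed.

Lemma re_mul_conj x y : re (x * Num.conj y) = re x * re y + im x * im y.
Proof. by case: x => a b; case: y => c d; rewrite /re /im /=; ring. Qed.

Lemma fdotE m n (X Y : 'M[C]_(m, n)) :
  fdot X Y = \sum_i \sum_j (re (X i j) * re (Y i j) + im (X i j) * im (Y i j)).
Proof.
rewrite !fdot.unlock /mxtrace re_sum; apply: eq_bigr => i _.
rewrite mxE re_sum; apply: eq_bigr => j _.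
by rewrite !mxE re_mul_conj.
Qed.

Lemma fdotC m n (X Y : 'M[C]_(m, n)) : fdot X Y = fdot Y X.
Proof.
rewrite !fdotE; apply: eq_bigr => i _; apply: eq_bigr => j _.
by rewrite mulrC; congr (_ + _); rewrite mulrC.
Qed.

Lemma fdotDl m n (X Y Z : 'M[C]_(m, n)) : fdot (X + Y) Z = fdot X Z + fdot Y Z.
Proof. by rewrite !fdot.unlock mulmxDl linearD reD. Qed.

Lemma fdotNl m n (X Z : 'M[C]_(m, n)) : fdot (- X) Z = - fdot X Z.
Proof. by rewrite !fdot.unlock mulNmx linearN reN. Qed.

Lemma fdotDr m n (X Y Z : 'M[C]_(m, n)) : fdot Z (X + Y) = fdot Z X + fdot Z Y.
Proof. by rewrite !(fdotC Z) fdotDl. Qed.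

Lemma fdotNr m n (X Z : 'M[C]_(m, n)) : fdot Z (- X) = - fdot Z X.
Proof. by rewrite !(fdotC Z) fdotNl. Qed.

Lemma fdotMl m n p (A : 'M[C]_(m, n)) (X : 'M[C]_(n, p)) Y :
  fdot (A *m X) Y = fdot X (ctmx A *m Y).
Proof. by rewrite !fdot.unlock ctmxM ctmxK -mulmxA mxtrace_mulC -mulmxA. Qed.

Lemma fdotMr m n p (A : 'M[C]_(n, p)) (X : 'M[C]_(m, n)) Y :
  fdot (X *m A) Y = fdot X (Y *m ctmx A).
Proof. by rewrite !fdot.unlock ctmxM ctmxK -!mulmxA. Qed.

Lemma fdot_ct m n (X Y : 'M[C]_(m, n)) : fdot (ctmx X) (ctmx Y) = fdot X Y.
Proof.
rewrite fdotC !fdot.unlock ctmxK mxtrace_mulC; congr (re _).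
Qed.

Lemma fdot_ge0 m n (X : 'M[C]_(m, n)) : 0 <= fdot X X.
Proof.
rewrite fdotE; apply: sumr_ge0 => i _; apply: sumr_ge0 => j _.
by rewrite -!expr2 addr_ge0 ?sqr_ge0.
Qed.

Lemma fnorm_ge0 m n (X : 'M[C]_(m, n)) : 0 <= fnorm X.
Proof. by rewrite fnorm.unlock sqrtr_ge0. Qed.

Lemma sqr_fnorm m n (X : 'M[C]_(m, n)) : fnorm X ^+ 2 = fdot X X.
Proof. by rewrite fnorm.unlock sqr_sqrtr // fdot_ge0. Qed.

(** The modulus with values in [R]; the norm of [C] itself takes values in [C]. *)
Definition modc (z : C) : R := Num.sqrt (re z ^+ 2 + im z ^+ 2).

Lemma normc_modc (z : C) : `|z| = ((modc z)%:C)%C.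
Proof. exact: normc_def. Qed.

Lemma modc_ge0 z : 0 <= modc z. Proof. exact: sqrtr_ge0. Qed.

Lemma modcM x y : modc (x * y) = modc x * modc y.
Proof. by apply: (@complexI R); rewrite -normc_modc normrM !normc_modc rmorphM. Qed.

Lemma modcD x y : modc (x + y) <= modc x + modc y.
Proof. by rewrite -lecR rmorphD /= -!normc_modc ler_normD. Qed.

Lemma modc0 : modc 0 = 0.
Proof. by apply: (@complexI R); rewrite -normc_modc normr0. Qed.

Lemma modc_gt0 z : z != 0 -> 0 < modc z.
Proof. by rewrite -ltcR -normc_modc normr_gt0. Qed.

Lemma modc_sum (I : Type) (s : seq I) (P : pred I) (F : I -> C) :
  modc (\sum_(i <- s | P i) F i) <= \sum_(i <- s | P i) modc (F i).
Proof.
elim/big_rec2: _ => [|i x y _ le]; first by rewrite modc0.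
by apply: le_trans (modcD _ _) _; rewrite lerD2l.
Qed.

Lemma sqr_fnormE m n (X : 'M[C]_(m, n)) :
  fnorm X ^+ 2 = \sum_i \sum_j modc (X i j) ^+ 2.
Proof.
rewrite sqr_fnorm fdotE; apply: eq_bigr => i _; apply: eq_bigr => j _.
by rewrite -!expr2 /modc sqr_sqrtr // addr_ge0 ?sqr_ge0.
Qed.

Lemma modc_le_fnorm m n (X : 'M[C]_(m, n)) i j : modc (X i j) <= fnorm X.
Proof.
rewrite -(ler_pXn2r (n := 2)) ?nnegrE ?modc_ge0 ?fnorm_ge0 // sqr_fnormE.
rewrite (bigD1 i) //= (bigD1 j) //= -addrA lerDl addr_ge0 //.
  by apply: sumr_ge0 => k _; rewrite sqr_ge0.
by apply: sumr_ge0 => k _; apply: sumr_ge0 => l _; rewrite sqr_ge0.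
Qed.

Lemma fnorm0 m n : fnorm (0 : 'M[C]_(m, n)) = 0.
Proof. by rewrite fnorm.unlock fdot.unlock mul0mx linear0 sqrtr0. Qed.

Lemma fnorm_eq0 m n (X : 'M[C]_(m, n)) : fnorm X <= 0 -> X = 0.
Proof.
move=> le; apply/matrixP => i j; rewrite mxE; apply/eqP.
apply: contraT => /modc_gt0.
by rewrite ltNge (le_trans (modc_le_fnorm X i j) le).
Qed.

Lemma fnorm_ct m n (X : 'M[C]_(m, n)) : fnorm (ctmx X) = fnorm X.
Proof. by rewrite !fnorm.unlock fdot_ct. Qed.

Lemma fnormN m n (X : 'M[C]_(m, n)) : fnorm (- X) = fnorm X.
Proof. by rewrite !fnorm.unlock fdotNl fdotNr opprK. Qed.

Lemma fnormBC m n (X Y : 'M[C]_(m, n)) : fnorm (X - Y) = fnorm (Y - X).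
Proof. by rewrite -fnormN opprB. Qed.

Lemma fdotDD m n (X Y : 'M[C]_(m, n)) :
  fdot (X + Y) (X + Y) = fdot X X + 2 * fdot X Y + fdot Y Y.
Proof. rewrite fdotDl !fdotDr (fdotC Y X); ring. Qed.

Lemma fdotBB m n (X Y : 'M[C]_(m, n)) :
  fdot (X - Y) (X - Y) = fdot X X - 2 * fdot X Y + fdot Y Y.
Proof. rewrite fdotDD fdotNr fdotNl fdotNr; ring. Qed.

Lemma fnormZ m n (c : C) (X : 'M[C]_(m, n)) : fnorm (c *: X) = modc c * fnorm X.
Proof.
apply/eqP; rewrite -(eqrXn2 (n := 2)) ?mulr_ge0 ?modc_ge0 ?fnorm_ge0 //.
apply/eqP; rewrite exprMn !sqr_fnormE mulr_sumr; apply: eq_bigr => i _.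
by rewrite mulr_sumr; apply: eq_bigr => j _; rewrite mxE modcM exprMn.
Qed.

(** Lagrange's identity: the squares of [a i * b j - a j * b i], summed over [i] and [j], give twice
    the difference of the two sides. *)
Lemma sum_CauchySchwarz (I : finType) (a b : I -> R) :
  (\sum_i a i * b i) ^+ 2 <= (\sum_i a i ^+ 2) * (\sum_i b i ^+ 2).
Proof.
have h : 0 <= \sum_i \sum_j (a i * b j - a j * b i) ^+ 2.
  by apply: sumr_ge0 => i _; apply: sumr_ge0 => j _; rewrite sqr_ge0.
have e : \sum_i \sum_j (a i * b j - a j * b i) ^+ 2 =
    2 * ((\sum_i a i ^+ 2) * (\sum_i b i ^+ 2)) - 2 * (\sum_i a i * b i) ^+ 2.
  have -> : \sum_i \sum_j (a i * b j - a j * b i) ^+ 2 =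
     \sum_i \sum_j ((a i ^+ 2 * b j ^+ 2 + b i ^+ 2 * a j ^+ 2)
                    - 2 * ((a i * b i) * (a j * b j))).
    by apply: eq_bigr => i _; apply: eq_bigr => j _; ring.
  under eq_bigr => i _ do rewrite sumrB big_split /= -!mulr_sumr.
  rewrite sumrB big_split /= -!mulr_suml -mulr_sumr -mulr_suml expr2; ring.
lra.
Qed.

Lemma fnormM m n p (X : 'M[C]_(m, n)) (Y : 'M[C]_(n, p)) :
  fnorm (X *m Y) <= fnorm X * fnorm Y.
Proof.
rewrite -(ler_pXn2r (n := 2)) ?nnegrE ?mulr_ge0 ?fnorm_ge0 //.
rewrite exprMn !sqr_fnormE mulr_suml; apply: ler_sum => i _.
rewrite exchange_big /= mulr_sumr; apply: ler_sum => j _.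
apply: le_trans (sum_CauchySchwarz _ _).
rewrite ler_pXn2r ?nnegrE ?modc_ge0 ?sumr_ge0 // => [|k _]; last first.
  by rewrite mulr_ge0 ?modc_ge0.
rewrite mxE; apply: le_trans (modc_sum _ _ _) _.
by apply: ler_sum => k _; rewrite modcM.
Qed.

Lemma fdot_CauchySchwarz m n (X Y : 'M[C]_(m, n)) :
  fdot X Y <= fnorm X * fnorm Y.
Proof.
(* The squared norm of [y X - x Y] is [2 x y (x y - fdot X Y)]; the case [x y = 0] is treated
   apart. *)
set x := fnorm X; set y := fnorm Y.
have h : 0 <= fdot ((y%:C)%C *: X - (x%:C)%C *: Y) ((y%:C)%C *: X - (x%:C)%C *: Y).
  exact: fdot_ge0.
have sc (a : R) (U V : 'M[C]_(m, n)) : fdot ((a%:C)%C *: U) V = a * fdot U V.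
  rewrite !fdot.unlock -scalemxAl mxtraceZ; case: (\tr _) => u v.
  by rewrite /re /= mul0r subr0.
rewrite fdotBB sc sc sc fdotC sc (fdotC _ (_ *: Y)) sc (fdotC _ (_ *: Y)) sc in h.
rewrite -!sqr_fnorm -/x -/y (fdotC Y X) in h.
have x0 : 0 <= x by apply: fnorm_ge0.
have y0 : 0 <= y by apply: fnorm_ge0.
have [xy|xy] := ltP 0 (x * y); first by nra.
suff : fnorm X = 0 \/ fnorm Y = 0.
  case=> e; rewrite /x /y e.
    have /fnorm_eq0-> : fnorm X <= 0 by rewrite e.
    by rewrite !fdot.unlock mul0mx mxtrace0 re0 mul0r.
  have /fnorm_eq0-> : fnorm Y <= 0 by rewrite e.
  by rewrite fdotC !fdot.unlock mul0mx mxtrace0 re0 mulr0.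
have : x * y = 0 by apply/eqP; rewrite eq_le xy mulr_ge0.
by move/eqP; rewrite mulf_eq0 => /orP[] /eqP; [left|right].
Qed.

Lemma fnormD m n (X Y : 'M[C]_(m, n)) : fnorm (X + Y) <= fnorm X + fnorm Y.
Proof.
rewrite -(ler_pXn2r (n := 2)) ?nnegrE ?addr_ge0 ?fnorm_ge0 //.
rewrite sqr_fnorm fdotDD -!sqr_fnorm.
have := fdot_CauchySchwarz X Y; lra.
Qed.

Lemma fnormB m n (X Y : 'M[C]_(m, n)) : fnorm (X - Y) <= fnorm X + fnorm Y.
Proof. by rewrite -(fnormN Y) fnormD. Qed.

Lemma fnorm_triangle m n (X Y Z : 'M[C]_(m, n)) :
  fnorm (X - Z) <= fnorm (X - Y) + fnorm (Y - Z).
Proof. by rewrite -[X - Z](subrKA Y) fnormD. Qed.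

Lemma fnorm_le m n (X Y : 'M[C]_(m, n)) : fnorm X <= fnorm (X - Y) + fnorm Y.
Proof. by rewrite -{1}[X](subrK Y) fnormD. Qed.

Lemma fnorm_sum m n (I : Type) (s : seq I) (P : pred I) (F : I -> 'M[C]_(m, n)) :
  fnorm (\sum_(i <- s | P i) F i) <= \sum_(i <- s | P i) fnorm (F i).
Proof.
elim/big_rec2: _ => [|i x y _ le]; first by rewrite fnorm0.
by apply: le_trans (fnormD _ _) _; rewrite lerD2l.
Qed.

(** Together with [modc_le_fnorm] this compares the norm with the entrywise topology. *)
Lemma fnorm_le_sum m n (X : 'M[C]_(m, n)) : fnorm X <= \sum_i \sum_j modc (X i j).
Proof.
rewrite {1}[X]matrix_sum_delta; apply: le_trans (fnorm_sum _ _ _) _.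
apply: ler_sum => i _; apply: le_trans (fnorm_sum _ _ _) _.
apply: ler_sum => j _; rewrite fnormZ ler_piMr ?modc_ge0 //.
rewrite -(ler_pXn2r (n := 2)) ?nnegrE ?ler01 ?fnorm_ge0 // sqr_fnormE expr1n.
rewrite (bigD1 i) //= (bigD1 j) //= mxE !eqxx big1 => [|k /negPf nk]; last first.
  by rewrite mxE nk andbF /= modc0 expr0n.
rewrite big1 => [|k /negPf nk]; last first.
  by rewrite big1 // => l _; rewrite mxE nk /= modc0 expr0n.
have -> : modc 1 = 1.
  by apply: (@complexI R); rewrite -normc_modc normr1.
by rewrite !addr0 expr1n.
Qed.

End Frobenius.

(** * Polar decomposition and the norm identity *)

HB.lock Definition alg (R : realType) (r : nat) (T : 'M[Cplx R]_r) : 'M[Cplx R]_r :=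
  psd_sqrt (absmx T).

Section PsdRoot.
Context {R : realType} {r : nat}.
Local Notation C := (Cplx R).
Implicit Types A B P T X Y : 'M[C]_r.

Lemma normal_diag A : A *m ctmx A = ctmx A *m A ->
  exists P (d : 'rV[C]_r), [/\ P *m ctmx P = 1%:M, ctmx P *m P = 1%:M &
    A = ctmx P *m diag_mx d *m P].
Proof.
move=> nA; have /orthomx_spectralP : A \is normalmx.
  by apply/normalmxP; rewrite -!ctmxE.
have := spectral_unitarymx A.
move: (spectralmx A) (spectral_diag A) => P d uP eA.
have PP : P *m ctmx P = 1%:M by rewrite ctmxE; apply/unitarymxP.
have PP' := mulmx1C PP.
by exists P, d; split=> //; rewrite ctmxE -invmx_unitary.
Qed.

Lemma gram_ge0 m (v : 'cV[C]_m) : 0 <= (ctmx v *m v) 0 0.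
Proof.
rewrite mxE; apply: sumr_ge0 => i _.
by rewrite !mxE mulrC mul_conjC_ge0.
Qed.

Lemma psd_gram X : psdmx (ctmx X *m X).
Proof.
split; first by rewrite ctmxM ctmxK.
by move=> v; rewrite -mulmxA -mulmxA mulmxA -ctmxM gram_ge0.
Qed.

Lemma psd_root_ex A : psdmx A -> exists B, psdmx B /\ B *m B = A.
Proof.
move=> [hA pA].
have [|P [d [PP PP' eA]]] := @normal_diag A; first by rewrite hA.
(* An eigenvalue is the value of the quadratic form at the unit eigenvector
   [ctmx P *m delta_mx j 0]. *)
have d0 j : 0 <= d 0 j.
  have := pA (ctmx P *m delta_mx j 0).
  rewrite {1}eA ctmxM ctmxK !mulmxA -(mulmxA _ P) PP mulmx1.
  rewrite -(mulmxA _ P) PP mulmx1 mxE (bigD1 j) //= big1 => [|k nk]; last first.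
    by rewrite !mxE (negPf nk) mulr0.
  rewrite addr0 !mxE eqxx mulr1 (bigD1 j) //= big1 => [|k nk]; last first.
    by rewrite !mxE (negPf nk) mulr0n mulr0.
  by rewrite !mxE !eqxx /= conjC1 mul1r addr0 mulr1n.
(* With a fourth root [q] of the diagonal, the square root of [A] can be written as the Gram matrix
   of [q *m P], which is positive by [psd_gram]. *)
have [q hq eq4] : exists2 q, ctmx q = q & q *m q *m (q *m q) = diag_mx d.
  exists (diag_mx (\row_j sqrtC (sqrtC (d 0 j)))).
    apply/matrixP => i j; rewrite !mxE eq_sym; case: eqP => [->|_]; last first.
      by rewrite !mulr0n conjC0.
    by rewrite !mulr1n; apply/CrealP/ger0_real; rewrite !sqrtC_ge0.
  rewrite !mulmx_diag; congr diag_mx; apply/rowP => j; rewrite !mxE.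
  by rewrite -[RHS]sqrtCK -[X in _ = X ^+ 2]sqrtCK; ring.
exists (ctmx (q *m P) *m (q *m P)); split; first exact: psd_gram.
move: (diag_mx d) eq4 eA => D <- ->.
by rewrite ctmxM hq !mulmxA (mulmx_rcancel _ PP).
Qed.

Lemma psd_sqrtP A : psdmx A -> psdmx (psd_sqrt A) /\ psd_sqrt A *m psd_sqrt A = A.
Proof.
move=> /psd_root_ex exB; rewrite /psd_sqrt.
by case: xgetP => [B _ [] //|nB]; have [B hB] := exB; case: (nB B).
Qed.

Lemma unitmx_sqr A B : A *m A = B -> B \in unitmx -> A \in unitmx.
Proof. by move=> <-; rewrite unitmx_mul andbb. Qed.

Lemma invmx_sqr A : A \in unitmx -> invmx (A *m A) = invmx A *m invmx A.
Proof.
move=> uA; have uAA : A *m A \in unitmx by rewrite unitmx_mul uA.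
by apply: (can_inj (mulKmx uAA)); rewrite mulmxV // mulmxA mulmxK // mulmxV.
Qed.

Lemma ctmx_unit A : (ctmx A \in unitmx) = (A \in unitmx).
Proof. by rewrite /ctmx unitmx_tr map_unitmx. Qed.

Lemma ctmx_inv A : ctmx (invmx A) = invmx (ctmx A).
Proof. by rewrite /ctmx map_invmx trmx_inv. Qed.

Lemma absmxP T : psdmx (absmx T) /\ absmx T *m absmx T = ctmx T *m T.
Proof. exact/psd_sqrtP/psd_gram. Qed.

Lemma absmx_unit T : T \in unitmx -> absmx T \in unitmx.
Proof.
by move=> uT; apply: (unitmx_sqr (absmxP T).2); rewrite unitmx_mul ctmx_unit uT.
Qed.

Lemma polarUP T : T \in unitmx -> polarU T \is unitarymx /\ T = polarU T *m absmx T.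
Proof.
move=> uT; rewrite /polarU; case: xgetP => [U _ [] //|nU].
have uA := absmx_unit uT; have [[hA _] AA] := absmxP T.
(* For invertible [T] the polar factor is [T |T|^-1], unitary because [|T|^2 = T^* T]. *)
case: (nU (T *m invmx (absmx T))); split; last by rewrite mulmxKV.
apply/unitarymxP; rewrite -ctmxE; apply: mulmx1C.
rewrite ctmxM ctmx_inv hA mulmxA -(mulmxA _ (ctmx T)) -AA.
by rewrite mulmxA mulVmx // mul1mx mulmxV.
Qed.

Lemma algE T : alg T = psd_sqrt (absmx T).
Proof. by rewrite alg.unlock. Qed.

Lemma algP T : [/\ ctmx (alg T) = alg T & alg T *m alg T = absmx T].
Proof. by rewrite algE; have [[? _] ?] := psd_sqrtP (absmxP T).1; split. Qed.

Lemma alg_unit T : T \in unitmx -> alg T \in unitmx.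
Proof. by move=> uT; apply: (unitmx_sqr (algP T).2); apply: absmx_unit. Qed.

(** Conjugation by [|T|^(1/2)], an algebra automorphism for invertible [T]; it will carry along
    whatever commutes with [T]. *)
Definition alconj T Y := alg T *m Y *m invmx (alg T).

(** [G U G = G (U G^2) G^-1], and [U G^2 = T]. *)
Lemma aluthgeE T : T \in unitmx -> aluthge T = alconj T T.
Proof.
move=> uT; have [_ eT] := polarUP uT; have [_ GG] := algP T.
have uG := alg_unit uT; rewrite /aluthge /alconj -algE.
have -> : alg T *m T = alg T *m (polarU T *m (alg T *m alg T)) by rewrite GG -eT.
by rewrite !mulmxA mulmxK.
Qed.

Lemma alconjM T X Y : T \in unitmx -> alconj T (X *m Y) = alconj T X *m alconj T Y.
Proof. by move=> uT; rewrite /alconj !mulmxA mulmxKV ?alg_unit. Qed.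

Lemma alconjD T X Y : alconj T (X + Y) = alconj T X + alconj T Y.
Proof. by rewrite /alconj mulmxDr mulmxDl. Qed.

Lemma alconj0 T : alconj T 0 = 0.
Proof. by rewrite /alconj mulmx0 mul0mx. Qed.

Lemma alconjB T X Y : alconj T (X - Y) = alconj T X - alconj T Y.
Proof. by rewrite /alconj mulmxBr mulmxBl. Qed.

Lemma alconjZ T (c : C) X : alconj T (c *: X) = c *: alconj T X.
Proof. by rewrite /alconj -scalemxAr -scalemxAl. Qed.

Lemma alconj_sum T (I : Type) (s : seq I) (F : I -> 'M[C]_r) :
  alconj T (\sum_(i <- s) F i) = \sum_(i <- s) alconj T (F i).
Proof. exact: (big_morph _ (alconjD T) (alconj0 T)). Qed.

Lemma alconj1 T : T \in unitmx -> alconj T 1%:M = 1%:M.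
Proof. by move=> uT; rewrite /alconj mulmx1 mulmxV ?alg_unit. Qed.

Lemma alconj_tr T Y : T \in unitmx -> \tr (alconj T Y) = \tr Y.
Proof. by move=> uT; rewrite /alconj mxtrace_mulC mulKmx ?alg_unit. Qed.

Lemma alconj_unit T Y : T \in unitmx -> Y \in unitmx -> alconj T Y \in unitmx.
Proof. by move=> uT uY; rewrite /alconj !unitmx_mul unitmx_inv alg_unit ?uY. Qed.

Lemma aluthge_unit T : T \in unitmx -> aluthge T \in unitmx.
Proof. by move=> uT; rewrite aluthgeE // alconj_unit. Qed.

Lemma alconj_inv T Y : T \in unitmx -> Y \in unitmx ->
  alconj T (invmx Y) = invmx (alconj T Y).
Proof.
move=> uT uY; have uZ := alconj_unit uT uY.
by rewrite -[LHS](mulKmx uZ) -alconjM // mulmxV // alconj1 // mulmx1.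
Qed.

(* [absdefect T Y] vanishes exactly when [Y] commutes with [|T|]. *)
Definition absdefect T Y := absmx T *m Y *m invmx (absmx T) - Y.

(** Conjugation by a self-adjoint [G] is a self-adjoint operator for [fdot], so it can be moved
    across, where it composes to conjugation by [G^2]. *)
Lemma fdot_conj (G H W : 'M[C]_r) : ctmx G = G -> G \in unitmx -> H = G *m G ->
  fdot (G *m W *m invmx G) (G *m W *m invmx G) = fdot (H *m W *m invmx H) W.
Proof.
move=> hG uG ->; rewrite fdotMr fdotMl [RHS]fdotC ctmx_inv hG (invmx_sqr uG).
by rewrite !mulmxA.
Qed.

(** With [F] the conjugation by [G], [F^2 - 1 = (F + 1)(F - 1)]. Being the square of conjugation by
    the self-adjoint [H], [F] is positive, so [F + 1] does not decrease norms. *)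
Lemma conj_move G H Y : ctmx H = H -> H *m H = G -> G \in unitmx ->
  fnorm (G *m Y *m invmx G - Y) <= fnorm (G *m G *m Y *m invmx (G *m G) - Y).
Proof.
move=> hH HH uG; have uH : H \in unitmx := unitmx_sqr HH uG.
rewrite (invmx_sqr uG); set W := G *m Y *m invmx G - Y.
have -> : G *m G *m Y *m (invmx G *m invmx G) - Y = G *m W *m invmx G + W.
  by rewrite /W mulmxBr mulmxBl !mulmxA subrKA.
move: W => W; rewrite -(ler_pXn2r (n := 2)) ?nnegrE ?fnorm_ge0 // !sqr_fnorm.
rewrite fdotDD -(fdot_conj W hH uH (esym HH)).
have := fdot_ge0 (H *m W *m invmx H).
have := fdot_ge0 (G *m W *m invmx G); lra.
Qed.

(* Conjugation by [A = |T|] acts on the commutant of [T = U A] as conjugation by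
   the unitary [U^*], while conjugation by [G = A^{1/2}] is a positive operator. *)
Lemma conj_defect T U A G Y : T = U *m A -> U *m ctmx U = 1%:M ->
  ctmx G = G -> G *m G = A -> G \in unitmx -> T *m Y = Y *m T ->
  fnorm (A *m Y *m invmx A - Y) ^+ 2 =
    2 * (fnorm Y ^+ 2 - fnorm (G *m Y *m invmx G) ^+ 2).
Proof.
move=> eT uU hG GG uG cTY; have uU' := mulmx1C uU.
have uA : A \in unitmx by rewrite -GG unitmx_mul uG.
have key : fdot (A *m Y *m invmx A) (A *m Y *m invmx A) = fdot Y Y.
  have eA : ctmx U *m T = A by rewrite eT mulmxA uU' mul1mx.
  have -> : A *m Y *m invmx A = ctmx U *m Y *m U.
    by rewrite -{1}eA -[_ *m T *m Y]mulmxA cTY eT -!mulmxA mulmxV ?mulmx1.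
  rewrite fdotMr fdotMl ctmxK !mulmxA uU mul1mx.
  by rewrite -mulmxA uU mulmx1.
rewrite !sqr_fnorm fdotBB key (fdot_conj Y hG uG (esym GG)); ring.
Qed.

Lemma alconj_defect T Y : T \in unitmx -> T *m Y = Y *m T ->
  fnorm (absdefect T Y) ^+ 2 = 2 * (fnorm Y ^+ 2 - fnorm (alconj T Y) ^+ 2).
Proof.
move=> uT cTY; have [hG GG] := algP T; have [/unitarymxP uU eT] := polarUP uT.
by apply: (conj_defect eT) => //; [rewrite ctmxE|exact: alg_unit].
Qed.

Lemma alconj_move T Y : T \in unitmx ->
  fnorm (alconj T Y - Y) <= fnorm (absdefect T Y).
Proof.
move=> uT; have [hG GG] := algP T.
have [[hH _] HH] := psd_sqrtP (psd_sqrtP (absmxP T).1).1.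
rewrite -algE in hH HH.
rewrite /absdefect -GG; exact: (conj_move _ hH HH (alg_unit uT)).
Qed.

Lemma alconj_le T Y : T \in unitmx -> T *m Y = Y *m T ->
  fnorm (alconj T Y) <= fnorm Y.
Proof.
move=> uT /(alconj_defect uT) e.
rewrite -(ler_pXn2r (n := 2)) ?nnegrE ?fnorm_ge0 //.
have := sqr_ge0 (fnorm (absdefect T Y)); lra.
Qed.

Lemma fnorm_absmx T : fnorm (absmx T) = fnorm T.
Proof.
have [[hA _] AA] := absmxP T.
rewrite fnorm.unlock; congr Num.sqrt; rewrite -[X in fdot X _]mulmx1 fdotMl hA AA.
by rewrite -fdotMl mulmx1.
Qed.

(** The adjoint of the commutator is [E T^* - T^* E]. As [T^* = A^2 T^-1] and [E] commutes with
    [T^-1], it equals [-[A^2, E] T^-1]; the Leibniz rule with [[A, E] = D A] bounds it. *)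
Lemma root_comm_le T A E D : T \in unitmx -> A \in unitmx -> A *m A = ctmx T *m T ->
  T *m E = E *m T -> D = A *m E *m invmx A - E ->
  fnorm (T *m ctmx E - ctmx E *m T) <= 2 * fnorm A ^+ 2 * fnorm (invmx T) * fnorm D.
Proof.
move=> uT uA AA cTE eD.
have cA : A *m E = D *m A + E *m A by rewrite eD mulmxBl mulmxKV // subrK.
have cTV : invmx T *m E = E *m invmx T.
  by apply: (can_inj (mulKmx uT)); rewrite mulKVmx // mulmxA cTE mulmxK.
have e : ctmx (T *m ctmx E - ctmx E *m T) =
    - ((A *m (D *m A) + (D *m A) *m A) *m invmx T).
  have eT : ctmx T = A *m A *m invmx T by rewrite AA mulmxK.
  rewrite ctmxB !ctmxM ctmxK eT -!(mulmxA (A *m A)) cTV !mulmxA -mulmxBl -[RHS]mulNmx.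
  congr (_ *m _); rewrite -[A *m A *m E]mulmxA cA mulmxDr (mulmxA A E) cA mulmxDl.
  by rewrite !mulmxA addrA opprD addrCA subrr addr0.
rewrite -fnorm_ct e fnormN; apply: le_trans (fnormM _ _) _.
have a0 := fnorm_ge0 A.
have h1 : fnorm (D *m A) <= fnorm D * fnorm A by exact: fnormM.
have h2 := le_trans (fnormM A (D *m A)) (ler_wpM2l a0 h1).
have h3 := le_trans (fnormM (D *m A) A) (ler_wpM2r a0 h1).
have h4 := le_trans (fnormD _ _) (lerD h2 h3).
apply: le_trans (ler_wpM2r (fnorm_ge0 (invmx T)) h4) _.
by rewrite le_eqVlt; apply/orP; left; apply/eqP; ring.
Qed.

(* Since [|T|^2 = T^* T], a commutator with [|T|] controls one with [T^*]. *)
Lemma ct_comm_le T E : T \in unitmx -> T *m E = E *m T ->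
  fnorm (T *m ctmx E - ctmx E *m T) <=
    2 * fnorm T ^+ 2 * fnorm (invmx T) * fnorm (absdefect T E).
Proof.
move=> uT cTE; rewrite -(fnorm_absmx T).
exact: (root_comm_le uT (absmx_unit uT) (absmxP T).2 cTE erefl).
Qed.

End PsdRoot.

(** * Idempotents commuting with [S] *)

Lemma subr_exchange (V : zmodType) (p q m n : V) :
  (p - q) - ((p - m) - (q - n)) = m - n.
Proof. by rewrite (opprD q) opprK (addrACA p) (addrC (- m)) -(opprB m) subKr. Qed.

Section RingFacts.
Variable K : pzRingType.
Variable k : nat.
Variable E : 'I_k -> K.
Hypothesis E_orth : forall i j, E i * E j = if i == j then E i else 0.
Hypothesis E_sum : \sum_i E i = 1.

(** Inserting [1 = \sum_l E l] on either side; the term [l = i] vanishes, so only off-diagonal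
    blocks of [X] remain. *)
Lemma resolution_comm i (X : K) :
  E i * X - X * E i = \sum_l (E i * X * E l - E l * X * E i).
Proof.
by rewrite sumrB -mulr_sumr -!mulr_suml E_sum mulr1 mul1r.
Qed.

Variable lam : 'I_k -> K.
Hypothesis lam_central : forall i (X : K), lam i * X = X * lam i.
Let M := \sum_i lam i * E i.

Lemma resolution_mull j : E j * M = lam j * E j.
Proof.
rewrite /M mulr_sumr (bigD1 j) //= big1 ?addr0 => [|i nij].
  by rewrite mulrA -lam_central -mulrA E_orth eqxx.
by rewrite mulrA -lam_central -mulrA E_orth eq_sym (negPf nij) mulr0.
Qed.

Lemma resolution_mulr j : M * E j = lam j * E j.
Proof.
rewrite /M mulr_suml (bigD1 j) //= big1 ?addr0 => [|i nij].
  by rewrite -mulrA E_orth eqxx.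
by rewrite -mulrA E_orth (negPf nij) mulr0.
Qed.

(** [M] acts as [lam j] on the left of the block and as [lam l] on its right; a spectral gap thus
    recovers the block from the commutator. *)
Lemma resolution_gap j l (X : K) :
  E j * (M * X - X * M) * E l = (lam j - lam l) * (E j * X * E l).
Proof.
have h1 : E j * (M * X) * E l = lam j * (E j * X * E l).
  by rewrite mulrA resolution_mull -!mulrA.
have h2 : E j * (X * M) * E l = lam l * (E j * X * E l).
  by rewrite (mulrA (E j)) -mulrA resolution_mulr mulrA -lam_central -!mulrA.
by rewrite [RHS]mulrBl -h1 -h2 mulrBr mulrBl.
Qed.

End RingFacts.

Section Idempotent.
Context {R : realType} {r : nat}.
Local Notation C := (Cplx R).
Implicit Types S T X Y E Z : 'M[C]_r.

(** For an idempotent, [fdot E (ctmx E)] is the real part of the trace. As conjugation preserves the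
    trace, norm and deviation from self-adjointness decrease together. *)
Lemma idem_defect E : E *m E = E ->
  fnorm (E - ctmx E) ^+ 2 = 2 * (fnorm E ^+ 2 - re (\tr E)).
Proof.
move=> EE; rewrite !sqr_fnorm fdotBB fdot_ct.
have -> : fdot E (ctmx E) = re (\tr E) by rewrite fdot.unlock ctmxK EE.
ring.
Qed.

(** A quantitative form of the fact that normal idempotents are self-adjoint: [V = E^* E - E]
    satisfies [E - E^* = V^* - V], and trace identities give [|E E^* - E^* E|^2 = 2 |V|^2]. *)
Lemma idem_comm_le E : E *m E = E ->
  fnorm (E - ctmx E) <= 2 * fnorm (E *m ctmx E - ctmx E *m E).
Proof.
move=> EE; have eF : ctmx E *m ctmx E = ctmx E by rewrite -ctmxM EE.
set V := ctmx E *m E - E.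
have hV : ctmx V = ctmx E *m E - ctmx E by rewrite /V ctmxB ctmxM ctmxK.
have t : fdot (E *m ctmx E) (E *m ctmx E) = fdot (ctmx E *m E) (ctmx E *m E).
  by rewrite fdotMr [RHS]fdotMl !ctmxK mulmxA.
have s : fdot (E *m ctmx E) (ctmx E *m E) = fdot E E.
  by rewrite fdotC fdotMl ctmxK mulmxA EE fdotC fdotMr ctmxK EE.
have s' : fdot (ctmx E *m E) E = fdot E E by rewrite fdotMl ctmxK EE.
have e1 : fnorm (E *m ctmx E - ctmx E *m E) ^+ 2 = 2 * fnorm V ^+ 2.
  by rewrite !sqr_fnorm !fdotBB t s s'; ring.
have e2 : fnorm (E - ctmx E) <= 2 * fnorm V.
  have -> : E - ctmx E = ctmx V - V by rewrite hV /V opprB [RHS]addrC subrKA.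
  by rewrite mulr2n mulrDl mul1r; apply: le_trans (fnormB _ _) _; rewrite fnorm_ct.
apply: le_trans e2 _; rewrite ler_pM2l ?ltr0n //.
rewrite -(ler_pXn2r (n := 2)) ?nnegrE ?fnorm_ge0 // e1.
have := sqr_ge0 (fnorm V); lra.
Qed.

Definition resolution k (E : 'I_k -> 'M[C]_r) :=
  (forall i j, E i *m E j = if i == j then E i else 0) /\ \sum_i E i = 1%:M.

(** Puts the eigenvalues of [N] on the idempotents of [S]: a diagonalizable model of [S] whose
    distance to [S] does not grow along the orbit. *)
Definition combine k (lam : 'I_k -> C) (E : 'I_k -> 'M[C]_r) :=
  \sum_i lam i *: E i.

Lemma resolution_gapmx k (lam : 'I_k -> C) (E : 'I_k -> 'M[C]_r) j l X : resolution E ->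
  E j *m (combine lam E *m X - X *m combine lam E) *m E l =
    (lam j - lam l) *: (E j *m X *m E l).
Proof.
move=> [E_orth E_sum].
pose mlam i : 'M[C]_r := (lam i)%:M.
have cen i (Y : 'M[C]_r) : mlam i * Y = Y * mlam i by apply/esym; apply: scalar_mxC.
have h := resolution_gap E_orth cen j l X.
have eM : \sum_i mlam i * E i = combine lam E.
  by apply: eq_bigr => i _; rewrite -mul_scalar_mx.
have eB : (lam j - lam l)%:M = mlam j - mlam l by rewrite /mlam raddfB.
rewrite eM in h; rewrite -[RHS]mul_scalar_mx eB; exact: h.
Qed.

(** Each off-diagonal block of [X] is a block of the commutator [W] divided by an eigenvalue gap,
    hence at most [g c^2 |W|] in norm; every index [l] contributes two blocks. *)
Lemma resolution_comm_le k (lam : 'I_k -> C) (g c : R) (E : 'I_k -> 'M[C]_r) i X :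
  resolution E -> 0 <= g ->
  (forall j l, j != l -> modc (lam j - lam l)^-1 <= g) ->
  (forall j l, j != l -> lam j != lam l) ->
  (forall j, fnorm (E j) <= c) ->
  fnorm (E i *m X - X *m E i) <=
    k%:R * (2 * (g * c ^+ 2)) * fnorm (combine lam E *m X - X *m combine lam E).
Proof.
move=> rE g0 gP lamI cP; set W := combine lam E *m X - X *m combine lam E.
have c0 : 0 <= c by apply: le_trans (cP i); apply: fnorm_ge0.
have blk j l : j != l -> fnorm (E j *m X *m E l) <= g * c ^+ 2 * fnorm W.
  move=> njl.
  have nz : lam j - lam l != 0 by rewrite subr_eq0 lamI.
  have -> : E j *m X *m E l = (lam j - lam l)^-1 *: (E j *m W *m E l).
    by rewrite /W resolution_gapmx // scalerA mulVf // scale1r.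
  rewrite fnormZ -mulrA; apply: ler_pM; rewrite ?modc_ge0 ?fnorm_ge0 ?gP //.
  apply: le_trans (fnormM _ _) _.
  apply: (@le_trans _ _ (c * fnorm W * c)); last first.
    by rewrite le_eqVlt; apply/orP; left; apply/eqP; ring.
  apply: ler_pM; rewrite ?fnorm_ge0 //; apply: le_trans (fnormM _ _) _.
  by apply: ler_wpM2r; rewrite ?fnorm_ge0.
have -> : E i *m X - X *m E i = \sum_l (E i *m X *m E l - E l *m X *m E i).
  by case: rE => _ sE; apply: resolution_comm.
apply: le_trans (fnorm_sum _ _ _) _.
apply: (@le_trans _ _ (\sum_(l < k) 2 * (g * c ^+ 2 * fnorm W))); last first.
  by rewrite sumr_const card_ord -mulr_natl le_eqVlt; apply/orP; left; apply/eqP; ring.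
apply: ler_sum => l _; have [->|nil] := eqVneq l i.
  by rewrite subrr fnorm0 !mulr_ge0 ?fnorm_ge0 ?sqr_ge0.
apply: le_trans (fnormB _ _) _.
have h1 := blk i l; have h2 := blk l i nil; rewrite eq_sym in h1.
have := h1 nil; lra.
Qed.

(** As [Z] commutes with [E], only [E - E^*] contributes. *)
Lemma comm_sub_ct Z E : Z *m E = E *m Z ->
  fnorm (Z *m ctmx E - ctmx E *m Z) <= 2 * fnorm Z * fnorm (E - ctmx E).
Proof.
move=> cZ; set D := E - ctmx E.
have -> : Z *m ctmx E - ctmx E *m Z = D *m Z - Z *m D.
  by rewrite /D mulmxBl mulmxBr cZ opprB [RHS]addrC subrKA.
apply: le_trans (fnormB _ _) _.
have h1 := fnormM D Z; have h2 := fnormM Z D.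
have h : fnorm D * fnorm Z + fnorm Z * fnorm D = 2 * fnorm Z * fnorm D by ring.
by rewrite -h; apply: lerD.
Qed.

(** The constant [L]. With [q = k * (2 * (g * c^2))], the chain of estimates yields
    [D <= 4 q a^2 b d + 4 q z D], and [8 q z <= 1] absorbs half of [D]. *)
Definition gapconst (k : nat) (g c a b : R) : R :=
  8 * (k%:R * (2 * (g * c ^+ 2))) * (a ^+ 2 * b).

(** [idem_comm_le] and [resolution_comm_le] reduce the claim to the commutator of
    [M = combine lam E] with the adjoint of [E i]. The part from [S] is bounded by the defect
    through [ct_comm_le]; the part from [Z = S - M] is a small multiple of the left-hand side. *)
Lemma idem_defect_le k (lam : 'I_k -> C) (g c a b z : R) (E : 'I_k -> 'M[C]_r) S i :
  resolution E -> 0 <= g ->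
  (forall j l, j != l -> modc (lam j - lam l)^-1 <= g) ->
  (forall j l, j != l -> lam j != lam l) ->
  (forall j, fnorm (E j) <= c) ->
  S \in unitmx -> (forall j, S *m E j = E j *m S) ->
  fnorm S <= a -> fnorm (invmx S) <= b -> fnorm (S - combine lam E) <= z ->
  8 * (k%:R * (2 * (g * c ^+ 2))) * z <= 1 ->
  fnorm (E i - ctmx (E i)) <= gapconst k g c a b * fnorm (absdefect S (E i)).
Proof.
move=> rE g0 gP lamI cP uS cSE aP bP zP small.
set M := combine lam E in zP; set Z := S - M in zP.
have EE : E i *m E i = E i by rewrite rE.1 eqxx.
set D := fnorm _; set q := k%:R * (2 * (g * c ^+ 2)) in small.
have h1 : D <= 2 * fnorm (E i *m ctmx (E i) - ctmx (E i) *m E i) by apply: idem_comm_le.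
have h2 := resolution_comm_le i (ctmx (E i)) rE g0 gP lamI cP.
rewrite -/q -/M in h2.
have cME : M *m E i = E i *m M.
  rewrite /M /combine mulmx_suml mulmx_sumr; apply: eq_bigr => l _.
  rewrite -scalemxAl -scalemxAr !rE.1 eq_sym.
  by case: eqP => [->|].
have cZ : Z *m E i = E i *m Z by rewrite /Z mulmxBl mulmxBr cSE cME.
have h3 : fnorm (M *m ctmx (E i) - ctmx (E i) *m M) <=
    fnorm (S *m ctmx (E i) - ctmx (E i) *m S) + fnorm (Z *m ctmx (E i) - ctmx (E i) *m Z).
  have -> : M *m ctmx (E i) - ctmx (E i) *m M =
    (S *m ctmx (E i) - ctmx (E i) *m S) - (Z *m ctmx (E i) - ctmx (E i) *m Z).
    by rewrite /Z mulmxBl mulmxBr subr_exchange.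
  exact: fnormB.
have h4 := ct_comm_le uS (cSE i); have h5 := comm_sub_ct cZ; rewrite -/D in h5.
have c0 : 0 <= c by apply: le_trans (cP i); apply: fnorm_ge0.
have q0 : 0 <= q by rewrite /q !mulr_ge0 ?sqr_ge0 ?ler0n.
have D0 : 0 <= D by apply: fnorm_ge0.
have d0 : 0 <= fnorm (absdefect S (E i)) by apply: fnorm_ge0.
have h6 : 2 * fnorm Z * D <= 2 * z * D by rewrite ler_wpM2r // ler_pM2l ?ltr0n.
have h7 : 2 * fnorm S ^+ 2 * fnorm (invmx S) * fnorm (absdefect S (E i)) <=
   2 * (a ^+ 2 * b) * fnorm (absdefect S (E i)).
  apply: ler_wpM2r => //; rewrite -mulrA ler_pM2l ?ltr0n //.
  have n0 := fnorm_ge0 S.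
  apply: ler_pM; rewrite ?fnorm_ge0 ?sqr_ge0 // ler_pXn2r ?nnegrE //.
  exact: le_trans aP.
have h8 := le_trans h3 (lerD (le_trans h4 h7) (le_trans h5 h6)).
have h9 := le_trans h2 (ler_wpM2l q0 h8).
have h10 : 8 * q * z * D <= 1 * D by apply: ler_wpM2r.
rewrite /gapconst -/q; move: h1 h9 h10; clear; move: (fnorm (absdefect _ _)) (a ^+2 * b) => d ab.
move: (fnorm _) => x; lra.
Qed.

End Idempotent.

(** * Displacement of the idempotents along an orbit *)

Section Orbit.
Context {R : realType} {r k : nat}.
Local Notation C := (Cplx R).
Variables (lam : 'I_k -> C) (g a b c z : R).
Hypothesis g_ge0 : 0 <= g.
Hypothesis gP : forall j l, j != l -> modc (lam j - lam l)^-1 <= g.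
Hypothesis lamI : forall j l, j != l -> lam j != lam l.
Hypothesis b_ge0 : 0 <= b.
Hypothesis small : 8 * (k%:R * (2 * (g * c ^+ 2))) * z <= 1.
Implicit Types (S : 'M[C]_r) (E : 'I_k -> 'M[C]_r).

(** The invariant of the orbit: its bounds concern matrices that commute with [S], so [alconj_le]
    hands them on to the next iterate. *)
Definition adapted E S := [/\ resolution E, S \in unitmx,
  (forall j, S *m E j = E j *m S), (forall j, fnorm (E j) <= c) &
  [/\ fnorm S <= a, fnorm (invmx S) <= b & fnorm (S - combine lam E) <= z]].

Lemma adapted_step E S : adapted E S ->
  adapted (fun i => alconj S (E i)) (aluthge S).
Proof.
move=> [[oE sE] uS cSE cP [aP bP zP]].
have cM : S *m combine lam E = combine lam E *m S.
  rewrite /combine mulmx_sumr mulmx_suml; apply: eq_bigr => i _.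
  by rewrite -scalemxAr -scalemxAl cSE.
split.
- split; last by rewrite -alconj_sum sE alconj1.
  by move=> i j; rewrite -alconjM // oE; case: eqP => // _; rewrite alconj0.
- exact: aluthge_unit.
- by move=> j; rewrite (aluthgeE uS) -!(alconjM _ _ uS) cSE.
- by move=> j; apply: le_trans (cP j); apply: alconj_le.
- split.
  + by apply: le_trans aP; rewrite aluthgeE //; apply: alconj_le.
  + apply: le_trans bP; rewrite aluthgeE // -alconj_inv //; apply: alconj_le => //.
    by rewrite mulmxV // mulVmx.
  + apply: le_trans zP.
    have -> : combine lam (fun i => alconj S (E i)) = alconj S (combine lam E).
      by rewrite /combine alconj_sum; apply: eq_bigr => i _; rewrite alconjZ.
    rewrite aluthgeE // -alconjB; apply: alconj_le => //.
    by rewrite mulmxBl mulmxBr cM.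
Qed.

Local Notation L := (gapconst k g c a b).

Lemma gapconst_ge0 : 0 <= L.
Proof.
have k0 : 0 <= k%:R :> R by apply: ler0n.
have gc : 0 <= g * c ^+ 2 by apply: mulr_ge0 => //; apply: sqr_ge0.
have ab : 0 <= a ^+ 2 * b by apply: mulr_ge0 => //; apply: sqr_ge0.
rewrite /gapconst; apply: mulr_ge0 => //; apply: mulr_ge0; first exact: ler0n.
by apply: mulr_ge0 => //; apply: mulr_ge0 => //; exact: ler0n.
Qed.

(* For [d] the defect of [E i] and [p], [p'] its distances to self-adjointness
   before and after a step, [p^2 - p'^2 = d^2] and [p <= L d] give
   [d <= 2 L (p - p')]: the displacements telescope. *)
Lemma potential_step E S i (E0 : 'M[C]_r) : adapted E S ->
  fnorm (alconj S (E i) - E0) + 2 * L * fnorm (alconj S (E i) - ctmx (alconj S (E i)))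
  <= fnorm (E i - E0) + 2 * L * fnorm (E i - ctmx (E i)).
Proof.
move=> [rE uS cSE cP [aP bP zP]].
have EE : E i *m E i = E i by rewrite rE.1 eqxx.
have EE' : alconj S (E i) *m alconj S (E i) = alconj S (E i) by rewrite -alconjM // EE.
have h1 := idem_defect EE; have h2 := idem_defect EE'.
have h3 := alconj_defect uS (cSE i); rewrite alconj_tr // in h2.
have h4 := alconj_move (E i) uS.
have h5 := fnorm_triangle (alconj S (E i)) (E i) E0.
have h6 := idem_defect_le i rE g_ge0 gP lamI cP uS cSE aP bP zP small.
have L0 := gapconst_ge0.
set p := fnorm (E i - ctmx _) in h1 h6 *.
set p' := fnorm (alconj S (E i) - ctmx _) in h2 *.
set d := fnorm (absdefect _ _) in h3 h4 h6.
have p0 : 0 <= p := fnorm_ge0 _; have p'0 : 0 <= p' := fnorm_ge0 _.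
have d0 : 0 <= d := fnorm_ge0 _.
have e : d ^+ 2 = p ^+ 2 - p' ^+ 2 by rewrite h1 h2 h3; ring.
have le_p : p' <= p.
  rewrite -(ler_pXn2r (n := 2)) ?nnegrE //; have := sqr_ge0 d; lra.
suff dle : d <= 2 * L * (p - p') by lra.
have [->|dn0] := eqVneq d 0; first by rewrite mulr_ge0 ?subr_ge0 //; lra.
have dpos : 0 < d by rewrite lt_neqAle eq_sym dn0.
rewrite -(ler_pM2l dpos) -expr2 e.
have -> : p ^+ 2 - p' ^+ 2 = (p + p') * (p - p') by ring.
have -> : d * (2 * L * (p - p')) = (2 * (L * d)) * (p - p') by ring.
apply: ler_wpM2r; first by rewrite subr_ge0.
lra.
Qed.

(** The reference [E0] of [potential_step] is the initial [E i], so the potential starts from its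
    self-adjointness term alone. *)
Lemma orbit_adapted E S n : adapted E S -> exists E',
  adapted E' (aluthge_iter n S) /\
  forall i, fnorm (E' i - E i) + 2 * L * fnorm (E' i - ctmx (E' i))
            <= 2 * L * fnorm (E i - ctmx (E i)).
Proof.
move=> aES; elim: n => [|n [E' [aE' pE']]].
  by exists E; split=> // i; rewrite subrr fnorm0 add0r.
exists (fun i => alconj (aluthge_iter n S) (E' i)); split.
  by rewrite /aluthge_iter iterS; apply: adapted_step.
by move=> i; apply: le_trans (pE' i); apply: potential_step.
Qed.

(** Since [P i] is self-adjoint, [E i] deviates from its adjoint by at most [2 eta]; it is displaced
    by at most [4 L eta], and [eta] more leads to [P i]. The term [z] is the distance from the
    iterate to its model. *)
Lemma orbit_near E (P : 'I_k -> 'M[C]_r) S n (eta : R) : adapted E S ->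
  (forall i, ctmx (P i) = P i) -> (forall i, fnorm (E i - P i) <= eta) ->
  fnorm (aluthge_iter n S - combine lam P) <=
    z + (\sum_i modc (lam i)) * ((1 + 4 * L) * eta).
Proof.
move=> aES hP nE; have [E' [[_ _ _ _ [_ _ zP]] pE']] := orbit_adapted n aES.
apply: le_trans (fnorm_triangle _ (combine lam E') _) _; apply: lerD => //.
rewrite /combine -sumrB; apply: le_trans (fnorm_sum _ _ _) _.
rewrite mulr_suml; apply: ler_sum => i _.
rewrite -scalerBr fnormZ; apply: ler_wpM2l; first exact: modc_ge0.
have h1 := fnorm_triangle (E' i) (E i) (P i).
have h2 : fnorm (E i - ctmx (E i)) <= 2 * eta.
  have -> : E i - ctmx (E i) = (E i - P i) - ctmx (E i - P i).
    by rewrite ctmxB hP opprB subrKA.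
  apply: le_trans (fnormB _ _) _; rewrite fnorm_ct; have := nE i; lra.
have L0 := gapconst_ge0.
have h3 : 0 <= 2 * L * fnorm (E' i - ctmx (E' i)).
  by rewrite mulr_ge0 ?fnorm_ge0 //; lra.
have h4 : 2 * L * fnorm (E i - ctmx (E i)) <= 2 * L * (2 * eta).
  by apply: ler_wpM2l => //; lra.
have := pE' i; have := nE i; lra.
Qed.

End Orbit.

(** * Continuity and compactness in the Frobenius norm *)

(** Allows the limits of all matrix entries to be taken along one ultrafilter on [nat]. *)
Lemma ultra_fmap (T U : Type) (f : T -> U) (F : set_system T) :
  UltraFilter F -> UltraFilter (fmap f F).
Proof.
move=> FU; split; first exact: fmap_proper_filter.
move=> G GF sFG; rewrite predeqE => A; split; last exact: sFG.
move=> GA; have [//|FnA] := in_ultra_setVsetC (f @^-1` A) FU.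
have GnA : G (~` A) by apply: sFG.
by have /filter_ex[? []] : G (A `&` ~` A) by exact: filterI.
Qed.

Section MatrixContinuity.
Context {R : realType} {r : nat}.
Local Notation C := (Cplx R).
Implicit Types (X Y N S : 'M[C]_r) (f h : 'M[C]_r -> 'M[C]_r).

(** Epsilon-delta continuity for [fnorm]; [nbhs_fnormP] links it to the matrix topology. *)
Definition fcont f X := forall e : R, 0 < e -> exists2 d : R, 0 < d &
  forall Y, fnorm (Y - X) < d -> fnorm (f Y - f X) < e.

Lemma fcont_cst A X : fcont (fun=> A) X.
Proof. by move=> e e0; exists 1 => // Y _; rewrite subrr fnorm0. Qed.

Lemma fcont_id X : fcont id X.
Proof. by move=> e e0; exists e. Qed.

Lemma fcont_ct X : fcont ctmx X.
Proof. by move=> e e0; exists e => // Y; rewrite -ctmxB fnorm_ct. Qed.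

Lemma fcontD f h X : fcont f X -> fcont h X -> fcont (fun Y => f Y + h Y) X.
Proof.
move=> cf ch e e0; have e2 : 0 < e / 2 by rewrite divr_gt0.
have [d d0 fd] := cf _ e2; have [d' d'0 hd] := ch _ e2.
exists (Num.min d d'); first by rewrite lt_min d0.
move=> Y; rewrite lt_min => /andP[/fd h1 /hd h2].
rewrite opprD addrACA; apply: le_lt_trans (fnormD _ _) _; lra.
Qed.

Lemma fcontN f X : fcont f X -> fcont (fun Y => - f Y) X.
Proof.
move=> cf e e0; have [d d0 fd] := cf _ e0; exists d => // Y /fd.
by rewrite -opprD fnormN.
Qed.

Lemma fcontB f h X : fcont f X -> fcont h X -> fcont (fun Y => f Y - h Y) X.
Proof. by move=> cf ch; apply: fcontD => //; apply: fcontN. Qed.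

Lemma fcont_comp f h X : fcont f X -> fcont h (f X) -> fcont (fun Y => h (f Y)) X.
Proof.
move=> cf ch e /ch[d d0 hd]; have [d' d'0 fd] := cf _ d0.
by exists d' => // Y /fd /hd.
Qed.

Lemma fnorm_subM X X' Y Y' : fnorm (X *m X' - Y *m Y') <=
  fnorm (X - Y) * fnorm X' + fnorm Y * fnorm (X' - Y').
Proof.
have -> : X *m X' - Y *m Y' = (X - Y) *m X' + Y *m (X' - Y').
  by rewrite mulmxBl mulmxBr subrKA.
by apply: le_trans (fnormD _ _) _; apply: lerD; apply: fnormM.
Qed.

Lemma fcontM f h X : fcont f X -> fcont h X -> fcont (fun Y => f Y *m h Y) X.
Proof.
move=> cf ch e e0.
set p := fnorm (f X); set q := fnorm (h X).
have p0 : 0 <= p := fnorm_ge0 _; have q0 : 0 <= q := fnorm_ge0 _.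
set m := p + q + 1; have m0 : 0 < m by rewrite /m; lra.
pose t := Num.min 1 (e / (2 * m)).
have t0 : 0 < t by rewrite lt_min ltr01 divr_gt0 // mulr_gt0.
have tm : t * m <= e / 2.
  have : t <= e / (2 * m) by rewrite ge_min lexx orbT.
  rewrite ler_pdivlMr ?mulr_gt0 //; lra.
have t1 : t <= 1 by rewrite ge_min lexx.
have [d d0 fd] := cf _ t0; have [d' d'0 hd] := ch _ t0.
exists (Num.min d d'); first by rewrite lt_min d0.
move=> Y; rewrite lt_min => /andP[/fd h1 /hd h2].
apply: le_lt_trans (fnorm_subM _ _ _ _) _.
have h3 := fnorm_le (h Y) (h X).
have h4 : fnorm (f Y - f X) * fnorm (h Y) <= t * (1 + q).
  by apply: ler_pM; rewrite ?fnorm_ge0 // -/q; [exact: ltW|move: h3; rewrite -/q; lra].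
have h5 : p * fnorm (h Y - h X) <= p * t by apply: ler_wpM2l => //; exact: ltW.
rewrite /m in tm; rewrite -/p; nra.
Qed.

Lemma fcont_bounded f X : fcont f X -> exists2 d : R, 0 < d &
  forall Y, fnorm (Y - X) < d -> fnorm (f Y) < fnorm (f X) + 1.
Proof.
move=> /(_ 1 ltr01)[d d0 fd]; exists d => // Y /fd h.
have := fnorm_le (f Y) (f X); lra.
Qed.

(** A row vector [v] killed by [S] would satisfy [v = - v (S - N) N^-1], whose norm is smaller than
    that of a nonzero [v]. *)
Lemma unitmx_near N S : N \in unitmx -> fnorm (S - N) * fnorm (invmx N) < 1 ->
  S \in unitmx.
Proof.
move=> uN near; rewrite unitmxE unitfE; apply/negP => /det0P[v v0 vS].
have e : v = - (v *m (S - N) *m invmx N).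
  by rewrite mulmxBr vS sub0r mulNmx opprK mulmxK.
have vpos : 0 < fnorm v.
  rewrite lt_neqAle fnorm_ge0 andbT eq_sym; apply/negP => /eqP h.
  by move: v0; rewrite (fnorm_eq0 (X := v)) ?eqxx ?h.
have h1 := fnormM (v *m (S - N)) (invmx N).
have h2 := ler_wpM2r (fnorm_ge0 (invmx N)) (fnormM v (S - N)).
have h3 : fnorm v <= fnorm v * (fnorm (S - N) * fnorm (invmx N)).
  by rewrite {1}e fnormN mulrA; apply: le_trans h1 h2.
have := ltr_pM2l vpos (fnorm (S - N) * fnorm (invmx N)) 1.
by rewrite near mulr1 => /idP; rewrite ltNge h3.
Qed.

Lemma fcont_inv N : N \in unitmx -> fcont invmx N.
Proof.
move=> uN e e0; set b := fnorm (invmx N); have b0 : 0 <= b := fnorm_ge0 _.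
set m := b + 1; have m1 : 1 <= m by rewrite /m; lra.
have mpos : 0 < m by lra.
(* In [S^-1 - N^-1 = - S^-1 (S - N) N^-1], the first bound gives [|S^-1| <= 2 m]; the second then
   makes the difference less than [e / 2]. *)
pose d := Num.min (2 * m)^-1 (e / (4 * m ^+ 2)).
have m2 : 0 < m ^+ 2 by rewrite exprn_gt0.
have d0 : 0 < d.
  by rewrite lt_min invr_gt0 mulr_gt0 //= divr_gt0 // mulr_gt0.
exists d => // S; rewrite lt_min => /andP[h1 h2].
set x := fnorm (S - N) in h1 h2; have x0 : 0 <= x := fnorm_ge0 _.
have xm : x * m < 1 / 2.
  by move: h1; rewrite -[_^-1]mul1r ltr_pdivlMr ?mulr_gt0 //; lra.
have xb : x * b < 1 / 2 by apply: le_lt_trans xm; rewrite ler_wpM2l // /m; lra.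
have uS : S \in unitmx by apply: (unitmx_near uN); rewrite -/x -/b; lra.
have e1 : invmx S - invmx N = - (invmx S *m (S - N) *m invmx N).
  by rewrite mulmxBr mulVmx // mulmxBl mul1mx mulmxK // opprB.
have h3 : fnorm (invmx S - invmx N) <= fnorm (invmx S) * x * b.
  rewrite e1 fnormN; apply: le_trans (fnormM _ _) _.
  by apply: ler_wpM2r => //; apply: fnormM.
have h4 := fnorm_le (invmx S) (invmx N); rewrite -/b in h4.
set y := fnorm (invmx S) in h3 h4; have y0 : 0 <= y := fnorm_ge0 _.
have h5 : y * (x * b) <= y * (1 / 2) by rewrite ler_wpM2l // ltW.
have y2 : y <= 2 * m by rewrite /m; lra.
have h6 : x * (4 * m ^+ 2) < e by rewrite -ltr_pdivlMr // mulr_gt0.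
have h7 : y * x * b <= (2 * m) * x * m.
  by apply: ler_pM => //; rewrite ?mulr_ge0 // ?ler_wpM2r // /m; lra.
have : (2 * m) * x * m = x * (4 * m ^+ 2) / 2 by field.
lra.
Qed.

(** Real and imaginary parts of all entries converge along a single ultrafilter finer than [\oo],
    hence are close to their limits at common, arbitrarily large indices. *)
Lemma cluster_ex (u : nat -> 'M[C]_r) (B : R) : (forall n, fnorm (u n) <= B) ->
  exists X, forall e : R, 0 < e -> forall m : nat, exists2 n, (m <= n)%N & fnorm (u n - X) < e.
Proof.
move=> uB.
have [F [UF sF]] := @ultraFilterLemma nat \oo _.
have lim_ex (v : nat -> R) : (forall n, `|v n| <= B) -> exists p : R, v @ F --> p.
  move=> vB; have := @segment_compact R (- B) B; rewrite compact_ultra => cB.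
  have vF : (v @ F) `[- B, B]%classic.
    suff : F (v @^-1` `[- B, B]) by [].
    by apply: filterE => n /=; rewrite in_itv /= -ler_norml; exact: vB.
  by have [p [_ vp]] := cB (v @ F) (ultra_fmap v UF) vF; exists p.
have le_re (z : C) : `|re z| <= modc z.
  rewrite -(ler_pXn2r (n := 2)) ?nnegrE ?normr_ge0 ?modc_ge0 // real_normK ?num_real //.
  by rewrite sqr_sqrtr ?addr_ge0 ?sqr_ge0 // lerDl sqr_ge0.
have le_im (z : C) : `|im z| <= modc z.
  rewrite -(ler_pXn2r (n := 2)) ?nnegrE ?normr_ge0 ?modc_ge0 // real_normK ?num_real //.
  by rewrite sqr_sqrtr ?addr_ge0 ?sqr_ge0 // lerDr sqr_ge0.
have exre (ij : 'I_r * 'I_r) : exists p : R, (fun n => re (u n ij.1 ij.2)) @ F --> p.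
  apply: lim_ex => n; apply: (le_trans (le_re (u n ij.1 ij.2))).
  exact: le_trans (modc_le_fnorm (u n) ij.1 ij.2) (uB n).
have exim (ij : 'I_r * 'I_r) : exists p : R, (fun n => im (u n ij.1 ij.2)) @ F --> p.
  apply: lim_ex => n; apply: (le_trans (le_im (u n ij.1 ij.2))).
  exact: le_trans (modc_le_fnorm (u n) ij.1 ij.2) (uB n).
have [p pP] := choice exre; have [q qP] := choice exim.
pose X : 'M[C]_r := \matrix_(i, j) (Complex (p (i, j)) (q (i, j)) : C).
exists X => e e0 N.
(* The [r * r] entries contribute at most [2 * t] each; the successor keeps the total strictly below
   [e] and covers [r = 0]. *)
pose t := e / (2 * (r * r).+1%:R).
have t0 : 0 < t by rewrite divr_gt0 // mulr_gt0 ?ltr0n.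
have near_ij : F [set n | forall ij : 'I_r * 'I_r,
    `|p ij - re (u n ij.1 ij.2)| < t /\ `|q ij - im (u n ij.1 ij.2)| < t].
  apply: filter_forall => ij; apply: filterI.
    by have /cvgrPdist_lt/(_ t t0) := pP ij.
  by have /cvgrPdist_lt/(_ t t0) := qP ij.
have geN : F [set n | (N <= n)%N] by apply: sF; exists N.
have [n [nN nP]] : ([set n | (N <= n)%N] `&` [set n | forall ij : 'I_r * 'I_r,
    `|p ij - re (u n ij.1 ij.2)| < t /\ `|q ij - im (u n ij.1 ij.2)| < t]) !=set0.
  by apply: (@filter_ex _ F); apply: filterI.
exists n => //; apply: le_lt_trans (fnorm_le_sum _) _.
have le_modc (z : C) : modc z <= `|re z| + `|im z|.
  rewrite -(ler_pXn2r (n := 2)) ?nnegrE ?addr_ge0 ?normr_ge0 ?modc_ge0 //.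
  rewrite sqr_sqrtr ?addr_ge0 ?sqr_ge0 // sqrrD !real_normK ?num_real //.
  have := mulr_ge0 (normr_ge0 (re z)) (normr_ge0 (im z)); lra.
apply: (@le_lt_trans _ _ (\sum_(i < r) \sum_(j < r) (2 * t))).
  apply: ler_sum => i _; apply: ler_sum => j _.
  apply: le_trans (le_modc _) _; have [] := nP (i, j) => /=.
  rewrite (distrC (p _)) (distrC (q _)) !mxE.
  case: (u n i j) => x y; rewrite /re /im /=; lra.
rewrite !sumr_const card_ord -mulrnA -[X in X < _]mulr_natr.
have -> : 2 * t = e / (r * r).+1%:R.
  by rewrite /t; move: (pnatr_eq0 R (r * r).+1); move: (_.+1%:R) => w /negbT w0; field.
rewrite mulrAC ltr_pdivrMr ?ltr0n // ltr_pM2l // ltr_nat //.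
Qed.

(** Transfers to a cluster point what holds asymptotically along the sequence: idempotency,
    commutation or normality, written as the vanishing of [f]. *)
Lemma cluster_zero (u : nat -> 'M[C]_r) X f :
  (forall e : R, 0 < e -> forall m : nat, exists2 n, (m <= n)%N & fnorm (u n - X) < e) ->
  fcont f X ->
  (forall e : R, 0 < e -> exists m : nat, forall n, (m <= n)%N -> fnorm (f (u n)) < e) ->
  f X = 0.
Proof.
move=> cX cf fu; apply: fnorm_eq0; apply/ler_addgt0Pr => e e0; rewrite add0r.
have e2 : 0 < e / 2 by rewrite divr_gt0.
have [d d0 fd] := cf _ e2; have [N NP] := fu _ e2.
have [n nN /fd h] := cX _ d0 N; have h2 := NP _ nN.
have := fnorm_le (f X) (f (u n)); rewrite fnormBC; lra.
Qed.

End MatrixContinuity.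

(** * Idempotents near approximate idempotents *)

(** An identity in one indeterminate: [ring] proves it for polynomials, and it is then evaluated at
    [e]. *)
Lemma newton_identity (K : comNzRingType) n (e : 'M[K]_n.+1) :
  let u := e *m e - e in
  let e' := e + (1%:M - e *+ 2) *m u in
  e' *m e' - e' = (u *m u *m u) *+ 4 - (u *m u) *+ 3.
Proof.
pose p : {poly K} := 'X; pose v := p * p - p; pose q := p + (1 - p *+ 2) * v.
have id : q * q - q = (v * v * v) *+ 4 - (v * v) *+ 3 by rewrite /q /v; ring.
have := congr1 (horner_mx e) id; rewrite /q /v /p.
by rewrite !(rmorphB, rmorphD, rmorphMn, rmorphM, rmorph1) /= !horner_mx_X.
Qed.

Section IdempotentNear.
Context {R : realType} {r : nat}.
Local Notation C := (Cplx R).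
Implicit Types (X Y N S E e : 'M[C]_r).

(** Newton's step for [e^2 = e], with [2 e - 1] in place of its inverse, as
    [(2 e - 1)^2 = 1 + 4 (e^2 - e)]. It is the polynomial [3 e^2 - 2 e^3]. *)
Definition newton e := e + (1%:M - e *+ 2) *m (e *m e - e).

Lemma newtonE e (u := e *m e - e) :
  newton e *m newton e - newton e = (u *m u *m u) *+ 4 - (u *m u) *+ 3.
Proof.
rewrite /u /newton; case: r e {u} => [|n] e; last exact: newton_identity.
by apply/matrixP => -[].
Qed.

Lemma modc_nat n : modc (n%:R : C) = n%:R :> R.
Proof. by apply: (@complexI R); rewrite -normc_modc normr_nat rmorph_nat. Qed.

Lemma fnormMn X n : fnorm (X *+ n) = n%:R * fnorm X.
Proof. by rewrite -scaler_nat fnormZ modc_nat. Qed.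

Lemma newton_contract e : fnorm (e *m e - e) <= 8^-1 ->
  2 * fnorm (newton e *m newton e - newton e) <= fnorm (e *m e - e).
Proof.
rewrite newtonE; set u := e *m e - e; move=> u8.
have h1 := fnormB ((u *m u *m u) *+ 4) ((u *m u) *+ 3).
rewrite !fnormMn in h1.
set x := fnorm u in u8 *; have x0 : 0 <= x := fnorm_ge0 _.
have h2 : fnorm (u *m u) <= x * x := fnormM _ _.
have h3 : fnorm (u *m u *m u) <= x * x * x.
  by apply: le_trans (fnormM _ _) _; apply: ler_wpM2r.
(* For [x <= 1/8], [4 x^3 + 3 x^2 <= (1/16 + 3/8) x <= x / 2]. *)
have h4 : x * x <= 8^-1 * x by apply: ler_wpM2r.
have h5 : x * x * x <= 8^-1 * 8^-1 * x.
  by apply: ler_wpM2r => //; apply: ler_pM.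
lra.
Qed.

Lemma newton_comm e Y : e *m Y = Y *m e -> newton e *m Y = Y *m newton e.
Proof.
move=> c; have c2 : (e *m e - e) *m Y = Y *m (e *m e - e).
  by rewrite mulmxBl mulmxBr -mulmxA c mulmxA c mulmxA.
have c1 : (1%:M - e *+ 2) *m Y = Y *m (1%:M - e *+ 2).
  by rewrite mulmxBl mulmxBr mul1mx mulmx1 !mulr2n mulmxDl mulmxDr c.
rewrite /newton; move: (e *m e - e) (1%:M - _) c1 c2 => u v c1 c2.
by rewrite mulmxDl mulmxDr c -mulmxA c2 mulmxA c1 mulmxA.
Qed.

(** The defects [x n] of the Newton iterates [w n] at least halve and each step moves by at most
    [K * x n], so [|w n - e| + 2 K x n] does not increase. A cluster point is idempotent and
    commutes with the commutant of [e], as the iterates do. *)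
Lemma idem_near e : let K := 2 * (fnorm e + 1) + fnorm (1%:M : 'M[C]_r) in
  fnorm (e *m e - e) <= 8^-1 -> 2 * K * fnorm (e *m e - e) <= 1 ->
  exists E, [/\ E *m E = E, fnorm (E - e) <= 2 * K * fnorm (e *m e - e) &
    forall Y, e *m Y = Y *m e -> E *m Y = Y *m E].
Proof.
move=> K u8 Ku; set x0 := fnorm (e *m e - e) in u8 Ku *.
pose w n := iter n newton e; pose x n := fnorm (w n *m w n - w n).
have K0 : 0 < K.
  by rewrite /K; have := fnorm_ge0 e; have := fnorm_ge0 (1%:M : 'M[C]_r); lra.
have x_ge0 n : 0 <= x n by apply: fnorm_ge0.
have inv n : [/\ x n <= x0, fnorm (w n - e) + 2 * K * x n <= 2 * K * x0,
    2 ^+ n * x n <= x0 & forall Y, e *m Y = Y *m e -> w n *m Y = Y *m w n].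
  elim: n => [|n [h1 h2 h3 h4]].
    by rewrite /x /w /= subrr fnorm0 add0r expr0 mul1r; split.
  have c8 : 2 * x n.+1 <= x n.
    by rewrite /x /w iterS; apply: newton_contract; apply: le_trans h1 u8.
  split.
  - have := x_ge0 n.+1; lra.
  - have h5 := fnorm_triangle (w n.+1) (w n) e.
    (* [K] bounds [|1 - 2 w n|], because [|w n - e| <= 2 K x0 <= 1]. *)
    have h6 : fnorm (w n.+1 - w n) <= K * x n.
      have -> : w n.+1 - w n = (1%:M - w n *+ 2) *m (w n *m w n - w n).
        by rewrite {1}/w iterS -/(w n) /newton addrC addKr.
      apply: le_trans (fnormM _ _) _; apply: ler_wpM2r; first exact: fnorm_ge0.
      apply: le_trans (fnormB _ _) _; rewrite fnormMn.
      have h7 := fnorm_le (w n) e.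
      have h8 : 0 <= 2 * K * x n by rewrite mulr_ge0 // mulr_ge0 // ltW.
      rewrite /K; lra.
    have h9 : 2 * K * x n.+1 <= K * x n.
      by rewrite -mulrA mulrCA ler_pM2l.
    lra.
  - apply: le_trans h3; rewrite exprSr -mulrA ler_wpM2l // exprn_ge0 //.
  - by move=> Y /h4; rewrite /w iterS; apply: newton_comm.
have x_small (t : R) : 0 < t -> exists m : nat, forall n, (m <= n)%N -> x n < t.
  move=> t0; have [m mP] := ltr_add_invr t0.
  exists m => n mn; apply: le_lt_trans mP; rewrite add0r.
  have [_ _ h3 _] := inv n.
  rewrite -[_^-1]mul1r ler_pdivlMr ?ltr0n //.
  apply: (@le_trans _ _ x0); last by apply: le_trans u8 _; lra.
  apply: le_trans h3; rewrite mulrC ler_wpM2r // -natrX ler_nat.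
  by apply: leq_trans (_ : n.+1 <= _)%N; rewrite ?ltnS // ltn_expl.
have wB n : fnorm (w n) <= fnorm e + 1.
  have [_ h2 _ _] := inv n; have := fnorm_le (w n) e.
  have h8 : 0 <= 2 * K * x n by rewrite mulr_ge0 // mulr_ge0 // ltW.
  lra.
have [E EP] := cluster_ex wB; exists E; split.
- apply/eqP; rewrite -subr_eq0; apply/eqP.
  pose f X := X *m X - X; rewrite -/(f E); apply: (cluster_zero EP).
    by apply: fcontB; [apply: fcontM; exact: fcont_id|exact: fcont_id].
  exact: x_small.
- apply/ler_addgt0Pr => t t0; have [n _ h] := EP t t0 0%N.
  have [_ h2 _ _] := inv n; have := fnorm_triangle E (w n) e.
  have h8 : 0 <= 2 * K * x n by rewrite mulr_ge0 // mulr_ge0 // ltW.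
  rewrite (fnormBC E (w n)); lra.
- move=> Y cY; apply/eqP; rewrite -subr_eq0; apply/eqP.
  pose f X := X *m Y - Y *m X; rewrite -/(f E); apply: (cluster_zero EP).
    by apply: fcontB; apply: fcontM; (exact: fcont_id || exact: fcont_cst).
  move=> t t0; exists 0%N => n _; have [_ _ _ h] := inv n.
  by rewrite /f h // subrr fnorm0.
Qed.

(** [|E| <= |E|^2] excludes norms strictly between 0 and 1. *)
Lemma small_idem E : E *m E = E -> fnorm E < 1 -> E = 0.
Proof.
move=> EE E1; apply: fnorm_eq0; have h := fnormM E E; rewrite EE in h.
have x0 := fnorm_ge0 E; nra.
Qed.

Lemma idem_cont f N : fcont f N -> f N *m f N = f N ->
  forall eta : R, 0 < eta -> exists2 d : R, 0 < d & forall S, fnorm (S - N) < d ->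
    exists E, [/\ E *m E = E, fnorm (E - f N) < eta &
      forall Y, f S *m Y = Y *m f S -> E *m Y = Y *m E].
Proof.
move=> cf fN eta eta0.
set P := f N in fN *; pose K := 2 * (fnorm P + 2) + fnorm (1%:M : 'M[C]_r).
have K0 : 0 < K.
  by rewrite /K; have := fnorm_ge0 P; have := fnorm_ge0 (1%:M : 'M[C]_r); lra.
(* The first two bounds meet the hypotheses of [idem_near] at [f S]; the third keeps its correction
   below [eta / 2], the other half being spent between [f S] and [f N]. *)
pose t := Num.min 8^-1 (Num.min (2 * K)^-1 (eta / (4 * K))).
have t0 : 0 < t by rewrite !lt_min !invr_gt0 !divr_gt0 ?mulr_gt0 ?ltr0n.
have [d1 d10 h1] := cf (eta / 2) ltac:(by rewrite divr_gt0).
have cu : fcont (fun X => f X *m f X - f X) N by apply: fcontB => //; apply: fcontM.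
have [d2 d20 h2] := cu t t0.
have [d3 d30 h3] := fcont_bounded cf.
exists (Num.min d1 (Num.min d2 d3)); first by rewrite !lt_min d10 d20.
move=> S; rewrite !lt_min => /andP[/h1 a1 /andP[/h2 a2 /h3 a3]].
rewrite /= -/P fN subrr subr0 in a2; rewrite -/P in a1 a3.
set x := fnorm (f S *m f S - f S) in a2.
have x0 : 0 <= x := fnorm_ge0 _.
move: a2; rewrite !lt_min => /andP[b1 /andP[b2 b3]].
have KK : 2 * (fnorm (f S) + 1) + fnorm (1%:M : 'M[C]_r) <= K by rewrite /K; lra.
have b2' : 2 * K * x <= 1.
  by move: b2; rewrite -[_^-1]mul1r ltr_pdivlMr ?mulr_gt0 // mulrC => /ltW.
have b3' : 4 * K * x < eta.
  by move: b3; rewrite ltr_pdivlMr ?mulr_gt0 // mulrC.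
have KKx := ler_wpM2r x0 KK.
have [||E [EE nE cE]] := idem_near (e := f S).
- exact: ltW.
- rewrite -/x; lra.
exists E; split=> //.
rewrite -/x in nE; have := fnorm_triangle E (f S) P; lra.
Qed.

End IdempotentNear.

(** * Resolutions of the identity for matrices near [N] *)

Lemma ord_pos_min (R : realType) k (d : 'I_k -> R) : (forall i, 0 < d i) ->
  exists2 d0 : R, 0 < d0 & forall i, d0 <= d i.
Proof.
move=> dP; exists (\big[Order.min/1]_i d i).
  by apply: lt_bigmin => // i _.
by move=> i; apply: bigmin_le.
Qed.

Section ResolutionNear.
Context {R : realType} {r k : nat}.
Local Notation C := (Cplx R).
Variables (lam : 'I_k -> C) (P : 'I_k -> 'M[C]_r).
Hypothesis lamI : forall j l, j != l -> lam j != lam l.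
Hypothesis rP : resolution P.
Let N := combine lam P.
Implicit Types (S X Y : 'M[C]_r).

(** Lagrange's interpolation polynomial for the node [lam i], evaluated at [S]; the list [s] of the
    other nodes allows induction. *)
Definition lagrange (s : seq 'I_k) (i : 'I_k) S : 'M[C]_r :=
  foldr (fun l X => ((lam i - lam l)^-1)%:M *m (S - (lam l)%:M) *m X) 1%:M s.

Lemma lagrange_fcont s i X : fcont (lagrange s i) X.
Proof.
elim: s => [|l s IHs]; first exact: fcont_cst.
apply: fcontM => //; apply: fcontM; first exact: fcont_cst.
by apply: fcontB; [exact: fcont_id|exact: fcont_cst].
Qed.

Lemma lagrange_comm s i S Y : S *m Y = Y *m S ->
  lagrange s i S *m Y = Y *m lagrange s i S.
Proof.
move=> c; elim: s => [|l s IHs]; first by rewrite /= mul1mx mulmx1.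
rewrite /= -/(lagrange s i S) -[LHS]mulmxA IHs !mulmxA; congr (_ *m _).
have cB : (S - (lam l)%:M) *m Y = Y *m (S - (lam l)%:M).
  by rewrite mulmxBl mulmxBr c (scalar_mxC _ Y).
by rewrite -[LHS]mulmxA cB mulmxA (scalar_mxC _ Y).
Qed.

Lemma combine_mulr j : N *m P j = lam j *: P j.
Proof.
have [oP _] := rP; rewrite /N /combine mulmx_suml (bigD1 j) //= big1.
  by rewrite addr0 -scalemxAl oP eqxx.
by move=> i nij; rewrite -scalemxAl oP (negPf nij) scaler0.
Qed.

Lemma lagrange_mul s i j : lagrange s i N *m P j =
  (\prod_(l <- s) ((lam i - lam l)^-1 * (lam j - lam l))) *: P j.
Proof.
elim: s => [|l s IHs]; first by rewrite big_nil /= mul1mx scale1r.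
rewrite /= -/(lagrange s i N) -[LHS]mulmxA IHs big_cons.
rewrite -scalemxAr -[_ *m _ *m P j]mulmxA mulmxBl combine_mulr.
by rewrite !mul_scalar_mx -scalerBl !scalerA -mulrA [in LHS]mulrC.
Qed.

Lemma lagrange_spectral i : lagrange [seq l <- enum 'I_k | l != i] i N = P i.
Proof.
have [oP sP] := rP; set s := [seq _ <- _ | _].
have -> : lagrange s i N = \sum_j lagrange s i N *m P j.
  by rewrite -mulmx_sumr sP mulmx1.
rewrite (bigD1 i) //= big1 ?addr0 => [|j nji]; rewrite lagrange_mul.
  rewrite big_seq big1 ?scale1r // => l; rewrite mem_filter => /andP[nli _].
  by rewrite mulVf // subr_eq0 lamI // eq_sym.
have js : j \in s by rewrite mem_filter nji mem_enum.
by rewrite (big_rem j) //= subrr mulr0 mul0r scale0r.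
Qed.

(** The [E i] come from the interpolation polynomials at [S], which equal the [P i] at [N]. They
    commute with [S] and with one another, so [E i *m E j] for [i != j] and [1 - \sum_i E i] are
    idempotents; being of norm less than 1, they vanish. *)
Lemma resolution_near (eta : R) : 0 < eta -> exists2 d : R, 0 < d &
  forall S, fnorm (S - N) < d -> exists E : 'I_k -> 'M[C]_r,
    [/\ resolution E, forall i, fnorm (E i - P i) <= eta &
        forall i, S *m E i = E i *m S].
Proof.
move=> eta0; have [oP sP] := rP.
pose p : R := \sum_i fnorm (P i).
have p0 : 0 <= p by apply: sumr_ge0 => i _; apply: fnorm_ge0.
have pP i : fnorm (P i) <= p.
  by rewrite /p (bigD1 i) //= lerDl; apply: sumr_ge0 => j _; apply: fnorm_ge0.
have kk0 : 0 <= k%:R :> R by apply: ler0n.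
(* The last two bounds keep the cross products and [1 - \sum_i E i] of norm less than 1. *)
pose t := Num.min eta (Num.min (4 * (p + 1))^-1 (2 * (k%:R + 1))^-1).
have t0 : 0 < t.
  rewrite !lt_min eta0 !invr_gt0 !mulr_gt0 //; lra.
have t_eta : t <= eta by rewrite ge_min lexx.
have tp : t * (4 * (p + 1)) <= 1.
  have : t <= (4 * (p + 1))^-1 by rewrite !ge_min lexx orbT.
  by rewrite -[_^-1]mul1r ler_pdivlMr // mulr_gt0 //; lra.
have tk : t * (2 * (k%:R + 1)) <= 1.
  have : t <= (2 * (k%:R + 1))^-1 by rewrite !ge_min lexx !orbT.
  by rewrite -[_^-1]mul1r ler_pdivlMr // mulr_gt0 //; lra.
pose f i := lagrange [seq l <- enum 'I_k | l != i] i.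
have fN i : f i N = P i := lagrange_spectral i.
have loc i : exists d : R, 0 < d /\ forall S, fnorm (S - N) < d ->
    exists E, [/\ E *m E = E, fnorm (E - P i) < t &
      forall Y, f i S *m Y = Y *m f i S -> E *m Y = Y *m E].
  have [||d d0 dP] := @idem_cont R r (f i) N _ _ t t0.
  - exact: lagrange_fcont.
  - by rewrite fN oP eqxx.
  by exists d; split=> // S /dP; rewrite fN.
have [d dP] := choice loc.
have [d0 d00 d0P] := @ord_pos_min R k d (fun i => (dP i).1).
exists d0 => // S Sd.
have exE i : exists E, [/\ E *m E = E, fnorm (E - P i) < t &
      forall Y, f i S *m Y = Y *m f i S -> E *m Y = Y *m E].
  by apply: (dP i).2; apply: lt_le_trans (d0P i).
have [E EP] := choice exE.
have cS i : E i *m S = S *m E i.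
  by have [_ _ c] := EP i; apply: c; apply: lagrange_comm.
have cE i j : E i *m E j = E j *m E i.
  by have [_ _ c] := EP i; apply: c; apply: lagrange_comm; rewrite cS.
have EE i : E i *m E i = E i by have [] := EP i.
have nE i : fnorm (E i - P i) < t by have [] := EP i.
have E0 i j : i != j -> E i *m E j = 0.
  move=> nij; apply: small_idem.
    by rewrite -mulmxA (mulmxA (E j)) (cE j i) -(mulmxA (E i) (E j)) EE mulmxA EE.
  have h1 := fnorm_subM (E i) (E j) (P i) (P j).
  rewrite oP (negPf nij) subr0 in h1; apply: le_lt_trans h1 _.
  have h2 := fnorm_le (E j) (P j); have h3 := nE i; have h4 := nE j.
  have h5 := pP i; have h6 := pP j.
  have h7 : fnorm (E i - P i) * fnorm (E j) <= t * (t + p).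
    by apply: ler_pM; rewrite ?fnorm_ge0 //; lra.
  have h8 : fnorm (P i) * fnorm (E j - P j) <= p * t.
    by apply: ler_pM; rewrite ?fnorm_ge0 //; lra.
  have t1 : t * t <= t * 1 by rewrite ler_pM2l //; nra.
  have h9 : 0 <= p * t by rewrite mulr_ge0 // ltW.
  lra.
have orE i j : E i *m E j = if i == j then E i else 0.
  by have [->|nij] := eqVneq i j; [exact: EE|exact: E0].
exists E; split; [|by move=> i; apply: le_trans t_eta; apply: ltW|
  by move=> i; rewrite cS].
split=> //; apply/esym/eqP; rewrite -subr_eq0; apply/eqP; apply: small_idem.
  have sE : (\sum_i E i) *m (\sum_i E i) = \sum_i E i.
    rewrite mulmx_suml; apply: eq_bigr => i _.
    rewrite mulmx_sumr (bigD1 i) //= big1 ?addr0 // => j nji.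
    by rewrite E0 // eq_sym.
  move: (\sum_i E i) sE => F FF.
  by rewrite mulmxBl mul1mx mulmxBr mulmx1 FF subrr subr0.
rewrite -sP -sumrB; apply: le_lt_trans (fnorm_sum _ _ _) _.
apply: (@le_lt_trans _ _ (\sum_(i < k) t)).
  by apply: ler_sum => i _; rewrite fnormBC ltW.
rewrite sumr_const card_ord -[X in X < _]mulr_natr.
have h9 : 0 <= t * k%:R by rewrite mulr_ge0 // ltW.
lra.
Qed.

End ResolutionNear.

(** * Stability and convergence *)

Section Stability.
Context {R : realType} {r : nat}.
Local Notation C := (Cplx R).
Implicit Types (A B N S T X Y : 'M[C]_r).

Lemma spectral_resolution N : N *m ctmx N = ctmx N *m N ->
  exists k (lam : 'I_k -> C) (P : 'I_k -> 'M[C]_r),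
  [/\ forall j l, j != l -> lam j != lam l, resolution P,
      forall i, ctmx (P i) = P i & N = combine lam P].
Proof.
move=> /normal_diag[U [d [UU UU' eN]]].
(* Repeated eigenvalues are merged, so that distinct indices have a nonzero gap. *)
pose s := undup [seq d 0 j | j <- enum 'I_r].
have d_s j : d 0 j \in s by rewrite mem_undup map_f ?mem_enum.
pose lam (i : 'I_(size s)) : C := s`_i.
have lamI (j l : 'I_(size s)) : j != l -> lam j != lam l.
  by move=> njl; rewrite /lam nth_uniq ?undup_uniq.
have lam_ex j : exists i, lam i = d 0 j.
  have lt : (index (d 0%R j) s < size s)%N by rewrite index_mem.
  by exists (Ordinal lt); rewrite /lam /= nth_index.
pose D i : 'M[C]_r := diag_mx (\row_j (d 0 j == lam i)%:R).
have DD i j : D i *m D j = if i == j then D i else 0.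
  rewrite /D mulmx_diag; apply/matrixP => p q; rewrite !mxE.
  have [<-|nij] := eqVneq i j; rewrite !mxE -natrM mulnb ?andbb //.
  have [e|_] := eqVneq (d 0 p) (lam i); last by rewrite mul0rn.
  by rewrite e (negPf (lamI _ _ nij)) mul0rn.
(* Used with [g] constant to sum the projections, and with [g] the identity to recover the diagonal
   matrix. *)
have Dsum (c : 'I_(size s) -> C) (g : C -> C) : (forall i, c i = g (lam i)) ->
    \sum_i c i *: D i = diag_mx (\row_j g (d 0 j)).
  move=> cg; apply/matrixP => p q; rewrite summxE !mxE.
  have [i ei] := lam_ex p.
  rewrite (bigD1 i) //= big1 ?addr0 => [|j nji]; rewrite !mxE -ei.
    by rewrite eqxx cg mulrnAr mulr1.
  by rewrite eq_sym (negPf (lamI _ _ nji)) mul0rn mulr0.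
have hD i : ctmx (D i) = D i.
  apply/matrixP => p q; rewrite !mxE; have [->|_] := eqVneq p q.
    by rewrite !mulr1n conjC_nat.
  by rewrite !mulr0n conjC0.
move: D DD Dsum hD => D DD Dsum hD.
exists (size s), lam, (fun i => ctmx U *m D i *m U); split; first exact: lamI.
- split=> [i j|].
    have -> : ctmx U *m D i *m U *m (ctmx U *m D j *m U) =
        ctmx U *m (D i *m D j) *m U.
      by rewrite !mulmxA (mulmx_rcancel _ UU).
    by rewrite DD; case: (i == j); [exact: erefl|rewrite mulmx0 mul0mx].
  rewrite -mulmx_suml -mulmx_sumr.
  have -> : \sum_i D i = 1%:M.
    transitivity (\sum_i (1 : C) *: D i).
      by apply: eq_bigr => i _; rewrite scale1r.
    rewrite (Dsum _ (fun=> 1)) //; apply/matrixP => p q.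
    by rewrite !mxE.
  by rewrite mulmx1.
- by move=> i; rewrite !ctmxM ctmxK hD mulmxA.
rewrite /combine eN.
transitivity (ctmx U *m (\sum_i lam i *: D i) *m U); last first.
  rewrite mulmx_sumr mulmx_suml; apply: eq_bigr => i _.
  by rewrite -scalemxAr -scalemxAl.
have -> : \sum_i lam i *: D i = diag_mx (\row_j d 0 j) by apply: (Dsum _ id).
by have -> : \row_j d 0 j = d by apply/rowP => j; rewrite mxE.
Qed.

Lemma normal_stable N : N \in unitmx -> N *m ctmx N = ctmx N *m N ->
  forall e : R, 0 < e -> exists2 d : R, 0 < d & forall S, fnorm (S - N) < d ->
    forall n, fnorm (aluthge_iter n S - N) <= e.
Proof.
move=> uN /spectral_resolution[k [lam [P [lamI rP hP eN]]]] e e0.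
pose g : R := \sum_j \sum_l modc (lam j - lam l)^-1.
have g0 : 0 <= g.
  by apply: sumr_ge0 => j _; apply: sumr_ge0 => l _; apply: modc_ge0.
have gP j l : j != l -> modc (lam j - lam l)^-1 <= g.
  move=> _; rewrite /g (bigD1 j) //= (bigD1 l) //= -addrA lerDl addr_ge0 //.
    by apply: sumr_ge0 => i _; apply: modc_ge0.
  by apply: sumr_ge0 => i _; apply: sumr_ge0 => h _; apply: modc_ge0.
(* The margins of one in [c], [a] and [b] cover the passage from [N] and the [P i] to a nearby [S]
   and its [E i]. *)
pose c : R := \sum_i fnorm (P i) + 1.
have cP i : fnorm (P i) + 1 <= c.
  rewrite lerD2r (bigD1 i) //= lerDl; apply: sumr_ge0 => j _; apply: fnorm_ge0.
pose a := fnorm N + 1; pose b := fnorm (invmx N) + 1.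
have b0 : 0 <= b by apply: addr_ge0 => //; apply: fnorm_ge0.
pose Q : R := k%:R * (2 * (g * c ^+ 2)).
have Q0 : 0 <= Q.
  have k0 : 0 <= k%:R :> R by apply: ler0n.
  apply: mulr_ge0 => //; apply: mulr_ge0 => //; apply: mulr_ge0 => //.
  exact: sqr_ge0.
pose L := gapconst k g c a b.
have L0 : 0 <= L by apply: gapconst_ge0.
pose M : R := \sum_i modc (lam i).
have M0 : 0 <= M by apply: sumr_ge0 => i _; apply: modc_ge0.
(* [z] takes at most half of the target and satisfies [8 Q z <= 1], as the orbit estimates require;
   [eta] will keep both [M eta] and the drift [M (1 + 4 L) eta] within [z / 2]. *)
pose z := Num.min (e / 2) (8 * Q + 1)^-1.
have Q1 : 0 < 8 * Q + 1 by lra.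
have z0 : 0 < z by rewrite lt_min divr_gt0 //= invr_gt0.
have z_e : z <= e / 2 by rewrite ge_min lexx.
have zQ : 8 * Q * z <= 1.
  have : z <= (8 * Q + 1)^-1 by rewrite ge_min lexx orbT.
  rewrite -[_^-1]mul1r ler_pdivlMr //; lra.
pose w := (M + 1) * (1 + 4 * L); have w0 : 0 < w by apply: mulr_gt0; lra.
have w1 : 1 <= w by rewrite /w; nra.
pose eta := Num.min 1 (z / (2 * w)).
have eta0 : 0 < eta by rewrite lt_min ltr01 divr_gt0 // mulr_gt0.
have eta1 : eta <= 1 by rewrite ge_min lexx.
have eta_w : w * eta <= z / 2.
  have : eta <= z / (2 * w) by rewrite ge_min lexx orbT.
  rewrite ler_pdivlMr ?mulr_gt0 //; lra.
have eta_M : M * ((1 + 4 * L) * eta) <= z / 2.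
  apply: le_trans eta_w; rewrite mulrA; apply: ler_wpM2r; first exact: ltW.
  by rewrite /w; apply: ler_wpM2r; lra.
have eta_M' : M * eta <= z / 2.
  apply: le_trans eta_M; apply: ler_wpM2l => //.
  by rewrite -[X in X <= _]mul1r; apply: ler_wpM2r; [exact: ltW|lra].
have [d1 d10 h1] := resolution_near lamI rP eta0; rewrite -eN in h1.
have [d2 d20 h2] := fcont_bounded (fcont_inv uN).
have n1 : 0 < fnorm (invmx N) + 1 by have := fnorm_ge0 (invmx N); lra.
exists (Num.min (Num.min d1 d2) (Num.min (Num.min 1 (z / 2)) (fnorm (invmx N) + 1)^-1)).
  by rewrite !lt_min d10 d20 ltr01 divr_gt0 //= invr_gt0.
move=> S; rewrite !lt_min => /andP[/andP[s1 s2] /andP[/andP[s3 s4] s5]] n.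
have [E [rE nE cE]] := h1 S s1.
have ad : adapted lam a b c z E S.
  split=> //.
  - apply: (unitmx_near uN).
    move: s5; rewrite -[_^-1]mul1r ltr_pdivlMr //.
    have := fnorm_ge0 (S - N); nra.
  - move=> j; have := cP j; have := nE j; have := fnorm_le (E j) (P j); lra.
  split.
  - have := fnorm_le S N; rewrite /a; lra.
  - exact/ltW/h2.
  have h3 : fnorm (N - combine lam E) <= M * eta.
    rewrite eN /combine -sumrB; apply: le_trans (fnorm_sum _ _ _) _.
    rewrite /M mulr_suml; apply: ler_sum => i _.
    by rewrite -scalerBr fnormZ ler_wpM2l ?modc_ge0 // fnormBC.
  have := fnorm_triangle S N (combine lam E); lra.
have := orbit_near g0 gP lamI b0 zQ n ad hP nE.
rewrite -eN -/M -/L; lra.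
Qed.

Lemma aluthge_iter_unit T n : T \in unitmx -> aluthge_iter n T \in unitmx.
Proof. by move=> uT; elim: n => // n IHn; apply: aluthge_unit. Qed.

Lemma aluthge_iter_bounds T n : T \in unitmx ->
  fnorm (aluthge_iter n T) <= fnorm T /\
  fnorm (invmx (aluthge_iter n T)) <= fnorm (invmx T).
Proof.
move=> uT; elim: n => // n [h1 h2]; have uTn := aluthge_iter_unit n uT.
rewrite /aluthge_iter iterS -/(aluthge_iter n T); move: (aluthge_iter n T) uTn h1 h2.
move=> S uS h1 h2; rewrite (aluthgeE uS) -(alconj_inv uS uS); split.
  by apply: le_trans h1; apply: alconj_le.
apply: le_trans h2; apply: alconj_le => //.
by rewrite (mulmxV uS) (mulVmx uS).
Qed.

(** The squared norms [u n] decrease to their infimum. Once within [t] of it, each further decrease,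
    which is half the squared defect of [S], is below [t], and [ct_comm_le] with [E = S] turns this
    into a bound on the commutator. *)
Lemma aluthge_iter_normal_limit T : T \in unitmx -> forall e : R, 0 < e ->
  exists m : nat, forall n, (m <= n)%N ->
    fnorm (aluthge_iter n T *m ctmx (aluthge_iter n T) -
           ctmx (aluthge_iter n T) *m aluthge_iter n T) < e.
Proof.
move=> uT e e0.
pose u n := fnorm (aluthge_iter n T) ^+ 2.
pose K := 2 * fnorm T ^+ 2 * fnorm (invmx T) + 1.
have K0 : 0 < K.
  have := sqr_ge0 (fnorm T); have := fnorm_ge0 (invmx T); rewrite /K; nra.
have u_lb n : 0 <= u n by apply: sqr_ge0.
have u_dec n : u n.+1 <= u n.
  rewrite /u ler_pXn2r ?nnegrE ?fnorm_ge0 //.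
  rewrite /aluthge_iter iterS -/(aluthge_iter n T).
  have uS := aluthge_iter_unit n uT; rewrite (aluthgeE uS).
  exact: alconj_le.
have u_mono m n : (m <= n)%N -> u n <= u m.
  by move=> /subnK <-; elim: (n - m)%N => // i IH; rewrite addSn; apply: le_trans IH.
pose t := (e / K) ^+ 2 / 2.
have t0 : 0 < t by rewrite divr_gt0 // exprn_gt0 // divr_gt0.
have hinf : has_inf (range u).
  by split; [exists (u 0%N); exists 0%N|exists 0 => _ [n _ <-]].
have [_ [m _ <-] um] := inf_adherent t0 hinf.
exists m => n mn; set S := aluthge_iter n T.
have uS : S \in unitmx := aluthge_iter_unit n uT.
have uinf : inf (range u) <= u n.+1 by apply: ge_inf; [exact: hinf.2|exists n.+1].
have h1 := alconj_defect uS (erefl (S *m S)).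
have eS : fnorm (alconj S S) ^+ 2 = u n.+1.
  by rewrite /u /aluthge_iter iterS -/(aluthge_iter n T) -/S (aluthgeE uS).
have h2 : fnorm (absdefect S S) ^+ 2 < (e / K) ^+ 2.
  have -> := h1; rewrite eS -/(u n); have um' := u_mono _ _ mn.
  have -> : (e / K) ^+ 2 = 2 * t by rewrite /t; field; rewrite gt_eqF.
  rewrite ltr_pM2l ?ltr0n //; lra.
have h3 : fnorm (absdefect S S) < e / K.
  by move: h2; rewrite ltr_pXn2r ?nnegrE ?fnorm_ge0 // divr_ge0 // ltW.
have [b1 b2] := aluthge_iter_bounds n uT; rewrite -/S in b1 b2.
apply: le_lt_trans (ct_comm_le uS (erefl _)) _.
have h4 : 2 * fnorm S ^+ 2 * fnorm (invmx S) <= K.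
  have h5 : fnorm S ^+ 2 * fnorm (invmx S) <= fnorm T ^+ 2 * fnorm (invmx T).
    by apply: ler_pM; rewrite ?sqr_ge0 ?fnorm_ge0 // ler_pXn2r ?nnegrE ?fnorm_ge0.
  by rewrite /K -!mulrA; lra.
rewrite ltr_pdivlMr // mulrC in h3; apply: le_lt_trans h3.
by apply: ler_wpM2r => //; apply: fnorm_ge0.
Qed.

Lemma aluthge_iter_cvg T : T \in unitmx -> exists N,
  [/\ N \in unitmx, N *m ctmx N = ctmx N *m N & forall e : R, 0 < e ->
    exists m : nat, forall n, (m <= n)%N -> fnorm (aluthge_iter n T - N) <= e].
Proof.
move=> uT.
have [N cN] := cluster_ex (fun n => (aluthge_iter_bounds n uT).1).
have nN : N *m ctmx N = ctmx N *m N.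
  apply/eqP; rewrite -subr_eq0; apply/eqP.
  pose f X := X *m ctmx X - ctmx X *m X; rewrite -/(f N); apply: (cluster_zero cN).
    by apply: fcontB; apply: fcontM; (exact: fcont_id || exact: fcont_ct).
  exact: aluthge_iter_normal_limit.
have b0 : 0 < fnorm (invmx T) + 1 by have := fnorm_ge0 (invmx T); lra.
(* The inverses of the iterates are bounded by [|T^-1|], so a sufficiently close iterate forces [N]
   to be invertible. *)
have uN : N \in unitmx.
  have [|n _ h] := cN (fnorm (invmx T) + 1)^-1 _ 0%N; first by rewrite invr_gt0.
  have [_ bn] := aluthge_iter_bounds n uT.
  apply: (unitmx_near (aluthge_iter_unit n uT)); rewrite fnormBC.
  move: h; rewrite -[_^-1]mul1r ltr_pdivlMr //.
  have := fnorm_ge0 (aluthge_iter n T - N); nra.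
exists N; split=> // e e0.
(* A single iterate in the stability neighbourhood of [N] traps all later ones. *)
have [d d0 dP] := normal_stable uN nN e0; have [m _ /dP hm] := cN d d0 0%N.
exists m => n mn; have := hm (n - m)%N.
by rewrite /aluthge_iter -iterD subnK.
Qed.

End Stability.

(** * Continuity *)

Section AluthgeContinuity.
Context {R : realType} {r : nat}.
Local Notation C := (Cplx R).
Implicit Types (A B N S T X Y : 'M[C]_r).

(* [b^2 - a^2 = b x + x a] for [x = b - a]; pairing with [x] and using
   [b >= 0], [a = g^2] bounds [|x g|^2] by [<b^2 - a^2, x>]. *)
Lemma root_lipschitz (a b g h : 'M[C]_r) : ctmx g = g -> g *m g = a -> g \in unitmx ->
  ctmx h = h -> h *m h = b ->
  fnorm (b - a) <= fnorm (invmx g) ^+ 2 * fnorm (b *m b - a *m a).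
Proof.
move=> hg gg ug hh hhb; set x := b - a; set G := fnorm (invmx g).
have ex : b *m b - a *m a = b *m x + x *m a.
  by rewrite /x mulmxBr mulmxBl subrKA.
have h1 : fdot (b *m b - a *m a) x = fdot (h *m x) (h *m x) + fdot (x *m g) (x *m g).
  rewrite ex fdotDl; congr (_ + _).
    by rewrite -hhb -mulmxA fdotMl hh.
  by rewrite -gg mulmxA fdotMr hg.
have h2 := fdot_CauchySchwarz (b *m b - a *m a) x.
have h3 := fdot_ge0 (h *m x); rewrite -(sqr_fnorm (x *m g)) in h1.
have h4 : fnorm x <= fnorm (x *m g) * G.
  by rewrite -{1}(mulmxK ug x); apply: fnormM.
have G0 : 0 <= G := fnorm_ge0 _; have x0 : 0 <= fnorm x := fnorm_ge0 _.
have y0 : 0 <= fnorm (x *m g) := fnorm_ge0 _.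
have [->|xn0] := eqVneq (fnorm x) 0.
  by apply: mulr_ge0; [exact: sqr_ge0|exact: fnorm_ge0].
have xpos : 0 < fnorm x by rewrite lt_neqAle eq_sym xn0.
rewrite -(ler_pM2l xpos).
have h5 : fnorm x * fnorm x <= (fnorm (x *m g) * G) * (fnorm (x *m g) * G).
  by apply: ler_pM.
apply: le_trans h5 _.
have -> : fnorm (x *m g) * G * (fnorm (x *m g) * G) = G ^+ 2 * fnorm (x *m g) ^+ 2 by ring.
rewrite [X in _ <= X]mulrCA; apply: ler_wpM2l; first exact: sqr_ge0.
rewrite [X in _ <= X]mulrC; lra.
Qed.

(** Only the fourth root of [A] is inverted, so the constant is uniform in [B]. *)
Lemma psd_sqrt_lipschitz A : psdmx A -> A \in unitmx -> exists2 K : R, 0 <= K &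
  forall B, psdmx B -> fnorm (psd_sqrt B - psd_sqrt A) <= K * fnorm (B - A).
Proof.
move=> pA uA; have [pa aa] := psd_sqrtP pA; have [[hg _] gg] := psd_sqrtP pa.
have ug : psd_sqrt (psd_sqrt A) \in unitmx.
  by apply: (unitmx_sqr gg); apply: (unitmx_sqr aa).
exists (fnorm (invmx (psd_sqrt (psd_sqrt A))) ^+ 2); first exact: sqr_ge0.
move=> B pB; have [pb bb] := psd_sqrtP pB; have [[hh _] hhb] := psd_sqrtP pb.
by have := root_lipschitz hg gg ug hh hhb; rewrite aa bb.
Qed.

Lemma fcont_psd_sqrt (f : 'M[C]_r -> 'M[C]_r) T : (forall X, psdmx (f X)) ->
  f T \in unitmx -> fcont f T -> fcont (fun X => psd_sqrt (f X)) T.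
Proof.
move=> pf uf cf e e0; have [K K0 KP] := psd_sqrt_lipschitz (pf T) uf.
have K1 : 0 < K + 1 by lra.
have [d d0 dP] := cf (e / (K + 1)) ltac:(by rewrite divr_gt0).
exists d => // Y /dP h; apply: le_lt_trans (KP _ (pf Y)) _.
move: h; rewrite ltr_pdivlMr //; have := fnorm_ge0 (f Y - f T); nra.
Qed.

Lemma fcont_alg T : T \in unitmx -> fcont (@alg R r) T.
Proof.
move=> uT.
suff : fcont (fun X => psd_sqrt (absmx X)) T.
  by move=> c e /c[d d0 dP]; exists d => // Y /dP; rewrite !algE.
apply: fcont_psd_sqrt; [by move=> X; have [] := absmxP X|exact: absmx_unit|].
apply: (@fcont_psd_sqrt (fun X => ctmx X *m X)); first exact: psd_gram.
  by rewrite unitmx_mul ctmx_unit uT.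
by apply: fcontM; [exact: fcont_ct|exact: fcont_id].
Qed.

Lemma unitmx_ball T : T \in unitmx -> exists2 d : R, 0 < d &
  forall S, fnorm (S - T) < d -> S \in unitmx.
Proof.
move=> uT; have b1 : 0 < fnorm (invmx T) + 1 by have := fnorm_ge0 (invmx T); lra.
exists (fnorm (invmx T) + 1)^-1; first by rewrite invr_gt0.
move=> S h; apply: (unitmx_near uT); move: h.
rewrite -[_^-1]mul1r ltr_pdivlMr //; have := fnorm_ge0 (S - T); nra.
Qed.

Lemma fcont_aluthge T : T \in unitmx -> fcont (@aluthge R r) T.
Proof.
move=> uT; have [d1 d10 d1P] := unitmx_ball uT.
have c : fcont (fun X => alconj X X) T.
  apply: fcontM; first by apply: fcontM; [exact: fcont_alg|exact: fcont_id].
  by apply: fcont_comp; [exact: fcont_alg|apply: fcont_inv; apply: alg_unit].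
move=> e /c[d d0 dP]; exists (Num.min d d1); first by rewrite lt_min d0.
move=> Y; rewrite lt_min => /andP[/dP h /d1P uY].
by rewrite (aluthgeE uT) (aluthgeE uY).
Qed.

Lemma fcont_aluthge_iter T n : T \in unitmx -> fcont (aluthge_iter n) T.
Proof.
move=> uT; elim: n => [|n IHn]; first exact: fcont_id.
apply: (fcont_comp IHn (h := @aluthge R r)); apply: fcont_aluthge.
exact: aluthge_iter_unit.
Qed.

Lemma nbhs_fnormP X (U : set 'M[C]_r) : nbhs X U <->
  exists2 e : R, 0 < e & forall Y, fnorm (Y - X) < e -> U Y.
Proof.
split=> [/nbhs_ballP[e /= e0 eU]|[e e0 eU]].
  (* Radii of balls are elements of [C]; a positive one is real. *)
  have [im_e re_e] : complex.Im e = 0 /\ 0 < complex.Re e.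
    by move: e0; rewrite ltcE => /andP[/eqP ? ?]; split.
  exists (complex.Re e) => // Y h; apply: eU; split=> // i j.
  rewrite -ball_normE /=; have := modc_le_fnorm (X - Y) i j.
  rewrite fnormBC in h; rewrite !mxE normc_modc ltcE /= im_e eqxx => h'.
  exact: le_lt_trans h' h.
pose w : R := (r * r).+1%:R; have w0 : 0 < w by rewrite ltr0n.
apply/nbhs_ballP; exists ((e / w)%:C)%C => /=.
  by rewrite ltcR divr_gt0.
move=> Y [_ hY]; apply: eU; apply: le_lt_trans (fnorm_le_sum _) _.
apply: (@le_lt_trans _ _ (\sum_(i < r) \sum_(j < r) (e / w))).
  apply: ler_sum => i _; apply: ler_sum => j _.
  have := hY i j; rewrite -ball_normE /= distrC normc_modc ltcR => /ltW.
  by rewrite !mxE.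
rewrite !sumr_const card_ord -mulrnA -[X in X < _]mulr_natr mulrAC.
by rewrite ltr_pdivrMr // ltr_pM2l // ltr_nat.
Qed.

Lemma aluthge_inf_eq T N : (forall e : R, 0 < e ->
    exists m : nat, forall n, (m <= n)%N -> fnorm (aluthge_iter n T - N) <= e) ->
  aluthge_inf T = N.
Proof.
move=> cN; apply: cvg_lim; last first.
  move=> U /nbhs_fnormP[e e0 eU].
  have [m mP] := cN (e / 2) ltac:(by rewrite divr_gt0).
  exists m => // n /= /mP h; apply: eU; lra.
(* Separation of the matrix topology, which [cvg_lim] requires. *)
move=> X Y cXY; apply/eqP; rewrite -subr_eq0; apply/eqP; apply: fnorm_eq0.
apply/ler_addgt0Pr => e e0; rewrite add0r.
have e2 : 0 < e / 2 by rewrite divr_gt0.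
have nX : nbhs X [set Z | fnorm (Z - X) < e / 2] by apply/nbhs_fnormP; exists (e / 2).
have nY : nbhs Y [set Z | fnorm (Z - Y) < e / 2] by apply/nbhs_fnormP; exists (e / 2).
have [Z [/= h1 h2]] := cXY _ _ nX nY.
have := fnorm_triangle X Z Y; rewrite (fnormBC X Z); lra.
Qed.

(** After [m] steps the orbit of [T] is within [d / 2] of its limit [N], and continuity of the
    [m]-th iterate brings that of [S] within [d]. Stability then keeps the orbit of [S], and so its
    limit, near [N]. *)
Lemma fcont_aluthge_inf T : T \in unitmx -> fcont (@aluthge_inf R r) T.
Proof.
move=> uT e e0; have [N [uN nN cN]] := aluthge_iter_cvg uT.
have e2 : 0 < e / 3 by rewrite divr_gt0.
have [d d0 dP] := normal_stable uN nN e2.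
have [m mP] := cN (d / 2) ltac:(by rewrite divr_gt0).
have [d1 d10 d1P] := fcont_aluthge_iter m uT (e := d / 2) ltac:(by rewrite divr_gt0).
have [d2 d20 d2P] := unitmx_ball uT.
exists (Num.min d1 d2); first by rewrite lt_min d10.
move=> S; rewrite lt_min => /andP[/d1P h1 /d2P uS].
rewrite (aluthge_inf_eq cN).
have h2 : fnorm (aluthge_iter m S - N) < d.
  have := fnorm_triangle (aluthge_iter m S) (aluthge_iter m T) N.
  have := mP m (leqnn m); lra.
have [N' [_ _ cN']] := aluthge_iter_cvg uS; rewrite (aluthge_inf_eq cN').
have [m' m'P] := cN' _ e2.
have h3 := m'P (m' + m)%N (leq_addr _ _).
have h4 : fnorm (aluthge_iter (m' + m) S - N) <= e / 3.
  by have := dP _ h2 m'; rewrite /aluthge_iter -iterD.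
have := fnorm_triangle N' (aluthge_iter (m' + m) S) N.
rewrite (fnormBC N' (aluthge_iter _ _)); lra.
Qed.

End AluthgeContinuity.

Theorem theorem5p5 (R : realType) (r : nat) (T : 'M[Cplx R]_r) :
  T \in unitmx -> {for T, continuous (@aluthge_inf R r)}.
Proof.
move=> uT U /nbhs_fnormP[e e0 eU].
have [d d0 dP] := fcont_aluthge_inf uT e0.
by apply/nbhs_fnormP; exists d => // Y /dP; apply: eU.
Qed.
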